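(* Let $a=(a_j)_{j\geq1}$ with $a_j\in[-1,1]$ and $\lambda=(\lambda_j)_{j\geq1}$ with $\lambda_j\in\mathbb{N}$ and $\lambda_{j+1}\geq 3\lambda_j$ for all $j$. Suppose that $\lambda_{j+1}\leq C\lambda_j$ for all $j$ for some fixed $C\geq 3$, and that \[ \liminf_{k\to\infty}\frac{-2\log|a_k|}{\log\lambda_k}=0 . \] Let \[ \mathcal{S}_\theta(s)=\sum_{k=1}^\infty \lambda_k^{s/\theta-1}\prod_{j=1}^{k}\left(1+|a_j|^{2/\theta}2^{1-2/\theta}\right). \] Then, for $\theta\in(0,1]$, \[ \dim_{\mathrm F}^{\theta}\mu_{a,\lambda}=\sup\{s\leq\theta:\mathcal{S}_\theta(s)<\infty\}, \] where $\mu_{a,\lambda}$ is the Riesz product associated with $a$ and $\lambda$.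
   Context: The Riesz product $\mu_{a,\lambda}=\prod_{j=1}^\infty(1+a_j\cos(2\pi\lambda_j x))$, $x\in[0,1]$, is the finite Borel measure on $[0,1]\subseteq\mathbb{R}$ obtained as the weak limit as $N\to\infty$ of the absolutely continuous measures on $[0,1]$ with densities $\prod_{j=1}^N(1+a_j\cos(2\pi\lambda_j x))$. For a finite Borel measure $\mu$ on $\mathbb{R}$ write $\widehat\mu(z)=\int e^{-2\pi i zx}\,d\mu(x)$, $z\in\mathbb{R}$. For $s\geq 0$ and $\theta\in(0,1]$ let $\mathcal{J}_{s,\theta}(\mu)=\left(\int_{\mathbb{R}}|\widehat\mu(z)|^{2/\theta}|z|^{s/\theta-1}\,dz\right)^{\theta}$. The Fourier spectrum of $\mu$ at $\theta$ is $\dim_{\mathrm F}^{\theta}\mu=\sup\{s\geq 0:\mathcal{J}_{s,\theta}(\mu)<\infty\}$, with $\sup\emptyset=0$. Convention: $-\log 0=+\infty$. *)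

(* Defs.v *)
From HB Require Import structures.
From mathcomp Require Import all_boot all_order all_algebra.
From mathcomp Require Import all_classical all_reals all_analysis.
From mathcomp Require Import complex.

Set Implicit Arguments.
Unset Strict Implicit.
Unset Printing Implicit Defensive.

Import Order.TTheory GRing.Theory Num.Theory.
Import numFieldNormedType.Exports.

Local Open Scope classical_set_scope.
Local Open Scope ring_scope.

(* Sequences indexed by j >= 1 on paper are indexed here by j >= 0: [a j] and
   [lam j] stand for a_(j+1) and lambda_(j+1). *)

Section RieszProduct.
Variable R : realType.
Implicit Types (a : R^nat) (lam : nat -> nat)
  (mu : {finite_measure set (measurableTypeR R) -> \bar R}).

Definition riesz_density a lam (N : nat) (x : R) : R :=
  \prod_(j < N) (1 + a j * cos (2 * pi * (lam j)%:R * x)).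

(* Weak convergence on the compact space [0, 1], hence the test functions are
   those continuous on [0, 1]. This determines [mu] uniquely. *)
Definition is_riesz_product a lam mu : Prop :=
  mu (~` `[0, 1]) = 0%E /\
  forall f : R -> R, {within `[0, 1], continuous f} ->
    \int[lebesgue_measure]_(x in `[0, 1]) (f x * riesz_density a lam N x)
      @[N --> \oo] --> \int[mu]_(x in `[0, 1]) f x.

Definition expi (t : R) : R[i] := Complex (cos t) (sin t).

Definition Cintegral mu (f : R -> R[i]) : R[i] :=
  Complex (\int[mu]_x complex.Re (f x)) (\int[mu]_x complex.Im (f x)).

Definition fourier_transform mu (z : R) : R[i] :=
  Cintegral mu (fun x => expi (- (2 * pi * z * x))).

Definition energy mu (s theta : R) : \bar R :=
  ((\int[lebesgue_measure]_z
     (Normc.normc (fourier_transform mu z) `^ (2 / theta)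
        * `|z| `^ (s / theta - 1))%:E) `^ theta)%E.

(* The maximum with 0 only implements the convention sup set0 = 0
   ([ereal_sup set0] is -oo). *)
Definition fourier_spectrum mu (theta : R) : \bar R :=
  maxe 0%E
    (ereal_sup [set s%:E | s in [set s : R | 0 <= s /\ (energy mu s theta < +oo)%E]]).

Definition riesz_series a lam (theta s : R) : \bar R :=
  (\sum_(0 <= k <oo)
     ((lam k)%:R `^ (s / theta - 1)
       * \prod_(j < k.+1) (1 + `|a j| `^ (2 / theta) * 2 `^ (1 - 2 / theta)))%:E)%E.

End RieszProduct.

(* Main.v *)
Require Import Defs.
From HB Require Import structures.
From mathcomp Require Import all_boot all_order all_algebra.
From mathcomp Require Import all_classical all_reals all_analysis.
From mathcomp Require Import measurable_realfun zify ring lra.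
From mathcomp Require Import complex.

(* Write p = 2/theta, <u> = 1 + |u|, and expand the partial products of the Riesz product as
   cosine sums with coefficients c_n over the set of frequencies n = sum e_j lambda_j,
   e_j in {-1, 0, 1}; the l^p mass of the first k levels is exactly the product P_k in the
   series S_theta. Up to an arbitrarily small loss in s, which the suprema absorb, both
   S_theta(s) < oo and the finiteness of the energy amount to P_k = O(lambda_k^(1 - s/theta)).

   From the series to the energy: the transform is dominated by sum_n |c_n| / <z - n>. Jensen's
   inequality with the weights <z - n>^-(1+d), uniformly summable because the frequencies are
   distinct integers, bounds its p-th power by sum_n |c_n|^p <z - n>^-b with b < 1 close to 1,
   and this is integrated against |z|^(s'/theta - 1) frequency by frequency.

   From the energy to the series: a kernel with decay <u>^-2 whose Fourier transform is constant
   on the support of mu reproduces the transform, so that |c_n|^p is at most a constant times the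
   integral of |mu^|^p against <z - n>^-2 + <z + n>^-2; summing over n bounds P_k.

   If s > theta, the same inequality makes a_k decay like a power of lambda_k, contradicting the
   hypothesis on the liminf. *)

Set Implicit Arguments.
Unset Strict Implicit.
Unset Printing Implicit Defensive.

Import Order.TTheory GRing.Theory Num.Theory.
Import numFieldNormedType.Exports.

Local Open Scope classical_set_scope.
Local Open Scope ring_scope.

(** * Brackets and power sums *)

(** Since p = 2/theta is in general not an even integer, p-th powers of sums over frequencies cannot
    be expanded; convexity replaces orthogonality, and both Jensen steps come from a single
    tangent-line inequality. The ratio 3 of lacunarity makes the signed sums of the lambda_j
    distinct, which is what bounds the weights. Two obstacles fix the exponents. An interval has
    endpoints, so the transform of Lebesgue measure on it decays only like <z>^-1, and the sum of <z
    - n>^-1 over all integers diverges; this forces the exponents 1 + d and b < 1 and the loss in s.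
    Conversely, a reproducing kernel must be integrable, which excludes a sharp cutoff at the
    support of mu; a trapezoid, the difference of two triangles, is flat on an interval of length 1
    and still has a transform decaying like <u>^-2. The growth bound lambda_(k+1) <= C lambda_k pays
    for a shift by one level: sampling measures P_k against lambda_(k+1), the series against
    lambda_k. *)

Section PowerSums.
Context {R : realType}.
Implicit Types (b p u v y z : R).

(** Convexity: b^p lies above its tangent at [y]. This is Young's inequality for b and y^(p-1) with
    exponents p and p/(p-1). *)
Lemma powR_tangent_ge p b y : 1 < p -> 0 <= b -> 0 <= y ->
  p * (b * y `^ (p - 1)) <= b `^ p + (p - 1) * y `^ p.
Proof.
move=> p1 b0 y0; have p0 : 0 < p by lra.
have q0 : 0 < p / (p - 1) by apply: divr_gt0 => //; lra.
have pV : p^-1 + (p / (p - 1))^-1 = 1.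
  by field; rewrite !gt_eqF //; lra.
have := conjugate_powR b0 (powR_ge0 y (p - 1)) p0 q0 pV.
have p10 : p - 1 != 0 by rewrite gt_eqF // subr_gt0.
rewrite -powRrM mulrCA divff // mulr1.
move=> /(ler_wpM2l (ltW p0)) /le_trans; apply.
rewrite mulrDr mulrCA divff ?gt_eqF// mulr1 lerD2l invf_div mulrCA.
by rewrite [p * _]mulrCA divff ?gt_eqF// mulr1 mulrC.
Qed.

(** The tangent inequality at [y = X / W], averaged against [w]. A total weight below [W] suffices
    because the constant term (p - 1) y^p is nonnegative, so one [W] serves all finite sets of
    frequencies. *)
Lemma jensen_sum (T : Type) (s : seq T) (w b : T -> R) p X W : 1 < p ->
  0 < W -> 0 <= X -> (forall i, 0 <= w i) -> (forall i, 0 <= b i) ->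
  \sum_(i <- s) w i <= W -> X <= \sum_(i <- s) w i * b i ->
  X `^ p <= W `^ (p - 1) * \sum_(i <- s) w i * b i `^ p.
Proof.
move=> p1 W0 X0 w0 b0 sW Xs; set S := \sum_(i <- s) _ * _ `^ _.
set y := X / W; have y0 : 0 <= y by rewrite divr_ge0 // ltW.
have XE : X = y * W by rewrite /y divfK // gt_eqF.
have H : p * (X * y `^ (p - 1)) <= S + (p - 1) * y `^ p * W.
  have : \sum_(i <- s) w i * (p * (b i * y `^ (p - 1))) <=
         \sum_(i <- s) w i * (b i `^ p + (p - 1) * y `^ p).
    by apply: ler_sum => i _; rewrite ler_wpM2l // powR_tangent_ge.
  under [X in _ <= X]eq_bigr do rewrite mulrDr.
  rewrite big_split /= -mulr_suml.
  under eq_bigr do rewrite mulrCA mulrA.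
  move=> h; apply: le_trans (le_trans h _); last first.
    rewrite lerD2l // mulrC ler_wpM2l // mulr_ge0 ?powR_ge0 //; lra.
  under [X in _ <= X]eq_bigr do rewrite [p * w _]mulrC -!mulrA [w _ * _]mulrCA [w _ * _]mulrA.
  rewrite -mulr_sumr -mulr_suml.
  by rewrite ler_pM2l ?ler_wpM2r ?powR_ge0 //; lra.
have yp : y * y `^ (p - 1) = y `^ p by rewrite mulr_powRB1 //; lra.
have {}H : W * y `^ p <= S.
  have : X * y `^ (p - 1) = W * y `^ p by rewrite XE mulrAC yp mulrC.
  move: H => /[swap] ->; set t := y `^ p; move=> H.
  have -> : W * t = p * (W * t) - (p - 1) * t * W by ring.
  by rewrite lerBlDr.
rewrite XE powRM // ?(ltW W0) // -[in W `^ p](mulr_powRB1 (ltW W0)); last by lra.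
rewrite mulrC -mulrA mulrCA ler_wpM2l ?powR_ge0 //.
Qed.

(** Discrete integral comparison: each term after the initial 1 is below a telescoping difference of
    d^-1 (k+1)^-d. *)
Lemma sum_powRN_le d n : 0 < d ->
  \sum_(0 <= k < n) (k.+1%:R : R) `^ (- (1 + d)) <= 1 + d^-1.
Proof.
move=> d0.
have step k : (k.+2%:R : R) `^ (- (1 + d)) <=
    d^-1 * (k.+1%:R `^ (- d) - k.+2%:R `^ (- d)).
  rewrite -ler_pdivrMl ?invr_gt0 // invrK.
  have e1 : (k.+2%:R : R) `^ (- (1 + d)) = k.+2%:R^-1 * k.+2%:R `^ (- d).
    by rewrite opprD powRD ?pnatr_eq0 ?implybT // powR_inv1.
  have e2 : (k.+1%:R : R) `^ (- d) =
      k.+2%:R `^ (- d) * (k.+1%:R / k.+2%:R) `^ (- d).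
    by rewrite -powRM ?ler0n ?divr_ge0 ?ler0n // mulrC divfK // pnatr_eq0.
  (* After division by (k+2)^-d the claim is 1 + d/(k+2) <= (1 - 1/(k+2))^-d, which follows from exp
     x >= 1 + x and ln (1 + x) <= x. *)
  rewrite e1 e2 mulrA -[X in _ - X]mulr1 -mulrBr mulrC ler_wpM2l ?powR_ge0 //.
  rewrite lerBrDl [X in _ <= X]/powR mulf_eq0 invr_eq0 !pnatr_eq0 /=.
  apply: le_trans (expR_ge1Dx _); rewrite lerD2l mulNr -mulrN ler_pM2l //.
  have q0 : 0 < (k.+1%:R / k.+2%:R : R) by rewrite divr_gt0 ?ltr0n.
  rewrite lerNr.
  have -> : (k.+1%:R / k.+2%:R : R) = 1 + - k.+2%:R^-1.
    apply/eqP; rewrite eq_sym subr_eq -[X in _ == _ + X]mul1r -mulrDl natr1.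
    by rewrite divff ?pnatr_eq0.
  by apply: le_ln1Dx; rewrite ltrN2 invf_lt1 ?ltr0n // ltr1n.
case: n => [|n]; first by rewrite big_geq // addr_ge0 // invr_ge0 ltW.
rewrite big_nat_recl // powR1 lerD2l.
apply: le_trans (_ : \sum_(0 <= i < n)
    d^-1 * ((i.+1%:R : R) `^ (- d) - i.+2%:R `^ (- d)) <= _).
  by apply: ler_sum => i _; exact: step.
rewrite -mulr_sumr -[X in _ <= X]mulr1 ler_wpM2l ?invr_ge0 ?(ltW d0) //.
under eq_bigr do rewrite -opprB.
rewrite sumrN (telescope_sumr (fun i => (i.+1%:R : R) `^ (- d))) // powR1 opprB.
by rewrite gerBl powR_ge0.
Qed.

Lemma ler_powRN u v e : 0 < u -> u <= v -> 0 <= e -> v `^ (- e) <= u `^ (- e).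
Proof.
move=> u0 uv e0; have v0 := lt_le_trans u0 uv.
by rewrite !powRN lef_pV2 ?posrE ?powR_gt0 // ge0_ler_powR // nnegrE ltW.
Qed.

(** The bracket <u> of the overview. Unlike (1 + u^2)^(1/2), it is submultiplicative with constant
    1. *)
Definition jb u : R := 1 + `|u|.

Lemma jb_ge1 u : 1 <= jb u. Proof. by rewrite lerDl. Qed.

Lemma jb_gt0 u : 0 < jb u. Proof. exact: lt_le_trans (jb_ge1 u). Qed.

Lemma jbN u : jb (- u) = jb u. Proof. by rewrite /jb normrN. Qed.

Lemma jbB u v : jb (u - v) = jb (v - u). Proof. by rewrite -jbN opprB. Qed.

Lemma jb_triangle u v : jb (u + v) <= jb u * jb v.
Proof.
apply: le_trans (_ : 1 + (`|u| + `|v|) <= _); first by rewrite lerD2l ler_normD.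
rewrite /jb; have := normr_ge0 u; have := normr_ge0 v; nra.
Qed.

(** Peetre's inequality: submultiplicativity gives [jb u / jb v <= jb (u - v)], and the power -e
    reverses it. It moves a weight from [z] to a frequency. *)
Lemma jb_peetre u v e : 0 <= e -> jb (u - v) `^ (- e) <= jb v `^ e * jb u `^ (- e).
Proof.
move=> e0; have -> : jb v `^ e * jb u `^ (- e) = (jb u / jb v) `^ (- e).
  rewrite powRM ?invr_ge0 ?(ltW (jb_gt0 _)) // -(powR_inv1 (ltW (jb_gt0 v))).
  by rewrite -powRrM mulrNN mul1r mulrC.
apply: ler_powRN => //; first by rewrite divr_gt0 ?jb_gt0.
by rewrite ler_pdivrMr ?jb_gt0 // (le_trans _ (jb_triangle _ _)) // subrK.
Qed.

Lemma jbV_powR_le1 u e : 0 <= e -> jb u `^ (- e) <= 1.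
Proof.
move=> e0; rewrite -[X in _ <= X](powRr0 (jb u)).
by apply: ler_powR; rewrite ?jb_ge1 // oppr_le0.
Qed.

Lemma ler_sum_uniq (T : eqType) (s t : seq T) (F : T -> R) :
  uniq s -> uniq t -> {subset s <= t} -> (forall i, 0 <= F i) ->
  \sum_(i <- s) F i <= \sum_(i <- t) F i.
Proof.
move=> us ut st F0.
have ps : perm_eq s [seq i <- t | i \in s].
  apply: uniq_perm => //; first exact: filter_uniq.
  by move=> i; rewrite mem_filter; case: (boolP (i \in s)) => // /st ->.
rewrite (perm_big _ ps) big_filter /= [X in _ <= X](bigID (mem s)) /=.
by rewrite lerDl sumr_ge0.
Qed.

(* Distinct integers are 1-separated, so the sum is dominated by a zeta series
   independently of the position of [z]. *)
Lemma sum_jb_int_le d z (s : seq int) : 0 < d -> uniq s ->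
  \sum_(n <- s) jb (z - n%:~R) `^ (- (1 + d)) <= 2 `^ (1 + d) * (2 * (1 + d^-1)).
Proof.
move=> d0 us; pose f := Num.floor z.
pose g (j : int) : R := (1 + `|j%:~R|) `^ (- (1 + d)).
have e0 : 0 <= 1 + d by lra.
(* Replacing [z] by its floor costs at most a factor 2 in the bracket, since |n - f| <= |z - n| +
   1. *)
have ptw n : jb (z - n%:~R) `^ (- (1 + d)) <= 2 `^ (1 + d) * g (n - f).
  have -> : 2 `^ (1 + d) * g (n - f) =
      ((1 + `|(n - f)%:~R|) / 2) `^ (- (1 + d)).
    rewrite powRM ?invr_ge0 ?addr_ge0 // mulrC; congr (_ * _).
    by rewrite -powR_inv1 // -powRrM mulN1r opprK.
  apply: ler_powRN; rewrite ?divr_gt0 ?ltr_wpDr //.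
  have /andP[zf zf1] : f%:~R <= z < (f + 1)%:~R by rewrite floor_itv.
  rewrite intrD in zf1; rewrite /jb intrB.
  by have [?|?] := ger0P (n%:~R - f%:~R : R); have [?|?] := ger0P (z - n%:~R); lra.
apply: le_trans (ler_sum _ (fun n _ => ptw n)) _.
rewrite -mulr_sumr ler_wpM2l ?powR_ge0 //.
rewrite -(big_map (fun n => n - f) xpredT g); set s' := map _ _.
have us' : uniq s' by rewrite map_inj_uniq // => x y /addIr.
(* [M] exceeds every |j|, so the shifted frequencies lie among k and -(k+1) with k < M. Each half is
   below the zeta sum, the brackets of the negative half being k + 2. *)
pose M := (\max_(j <- s') `|j|%N).+1.
pose t := [seq Posz k | k <- iota 0 M] ++ [seq Negz k | k <- iota 0 M].
have g0 j : 0 <= g j by exact: powR_ge0.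
apply: le_trans (@ler_sum_uniq _ s' t _ us' _ _ g0) _.
- rewrite cat_uniq !map_inj_uniq ?iota_uniq // => [|x y []|x y []] //.
  by rewrite andbT; apply/hasPn => x /mapP[k _ ->]; apply/mapP => -[].
- move=> j js; have jM : (`|j|%N < M)%N by rewrite ltnS (leq_bigmax_seq (F := absz)).
  rewrite mem_cat; case: j js jM => k js jM; apply/orP; [left|right];
    apply/mapP; exists k => //; rewrite mem_iota /=; move: jM => /=; lia.
- rewrite big_cat !big_map mulr_natl mulr2n /=.
  have := sum_powRN_le M d0; rewrite /index_iota subn0 => H.
  apply: lerD; apply: le_trans H; apply: ler_sum => k _.
    by rewrite /g /= normr_nat nat1r.
  apply: ler_powRN => //.
  by rewrite NegzE mulrNz normrN /= normr_nat lerDr.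
Qed.

(* Either [z] or [z - n] is comparable to [n]; the smaller bracket carries the
   whole decay [b + c - t]. *)
Lemma jb_three b c t n z : 0 <= t -> t <= b -> t <= c ->
  jb n `^ t * (jb (z - n) `^ (- b) * jb z `^ (- c)) <=
  2 `^ t * (jb z `^ (- (b + c - t)) + jb (z - n) `^ (- (b + c - t))).
Proof.
move=> t0 tb tc.
(* [v] carries the larger bracket: it absorbs <n>^t, and its remaining decay e1 - t >= 0 is handed
   to the smaller one. *)
have key u v e1 e2 : jb u <= jb v -> jb n <= 2 * jb v -> t <= e1 ->
    jb n `^ t * (jb v `^ (- e1) * jb u `^ (- e2)) <=
    2 `^ t * jb u `^ (- (e1 + e2 - t)).
  move=> uv nv te; apply: le_trans (_ : 2 `^ t * jb v `^ t *
      (jb v `^ (- e1) * jb u `^ (- e2)) <= _).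
    rewrite ler_wpM2r ?mulr_ge0 ?powR_ge0 // -powRM ?(ltW (jb_gt0 _)) //.
    by rewrite ge0_ler_powR ?nnegrE ?mulr_ge0 ?(ltW (jb_gt0 _)).
  rewrite -mulrA ler_wpM2l ?powR_ge0 // mulrA -powRD; last first.
    by rewrite (gt_eqF (jb_gt0 v)) implybT.
  have -> : - (e1 + e2 - t) = - (e1 - t) + - e2 by ring.
  rewrite [X in _ <= X]powRD ?(gt_eqF (jb_gt0 u)) ?implybT // ler_wpM2r ?powR_ge0 //.
  rewrite -[t - e1]opprB; apply: ler_powRN => //; [exact: jb_gt0|lra].
have tri : jb n <= jb z + jb (z - n).
  have : `|n| <= `|z| + `|z - n|.
    by have := ler_normB z (z - n); rewrite subKr.
  rewrite /jb; lra.
have [le|/ltW le] := lerP (jb z) (jb (z - n)).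
  apply: le_trans (key _ _ b c le _ tb) _; first lra.
  by rewrite ler_wpM2l ?powR_ge0 // lerDl powR_ge0.
rewrite [X in _ * X <= _]mulrC.
apply: le_trans (key _ _ c b le _ tc) _; first lra.
by rewrite [c + b]addrC ler_wpM2l ?powR_ge0 // lerDr powR_ge0.
Qed.

End PowerSums.

(** * Cosine expansion of the partial products *)

Section RieszTerms.
Context {R : realType}.
Variables (a : R^nat) (lam : nat -> nat).
Hypothesis lam_pos : forall j, (0 < lam j)%N.
Hypothesis lam_lacunary : forall j, (3 * lam j <= lam j.+1)%N.

(* The pairs (frequency, coefficient) in the cosine expansion of the partial product. *)
Fixpoint riesz_terms (N : nat) : seq (int * R) :=
  if N is k.+1 then
    riesz_terms k ++
    ([seq (t.1 + (lam k)%:Z, t.2 * (a k / 2)) | t <- riesz_terms k] ++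
     [seq (t.1 - (lam k)%:Z, t.2 * (a k / 2)) | t <- riesz_terms k])
  else [:: (0, 1)].

Lemma sum_riesz_termsS (F : int -> R -> R) k :
  \sum_(t <- riesz_terms k.+1) F t.1 t.2 =
  \sum_(t <- riesz_terms k) (F t.1 t.2 + (F (t.1 + (lam k)%:Z) (t.2 * (a k / 2)) +
                                    F (t.1 - (lam k)%:Z) (t.2 * (a k / 2)))).
Proof. by rewrite /= !big_cat /= !big_map !big_split. Qed.

(** Each level adds and subtracts [lam k] with the same weight, so coefficients are even in the
    frequency. A cosine sees n and -n alike and produces pairs z + n, z - n; this merges them. *)
Lemma sum_riesz_terms_opp (F : int -> R -> R) N :
  \sum_(t <- riesz_terms N) F (- t.1) t.2 = \sum_(t <- riesz_terms N) F t.1 t.2.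
Proof.
elim: N F => [|k IH] F; first by rewrite !big_seq1 oppr0.
rewrite sum_riesz_termsS (sum_riesz_termsS (fun n c => F (- n) c)).
rewrite -(IH (fun n c => F n c + (F (n + (lam k)%:Z) (c * (a k / 2)) +
                                 F (n - (lam k)%:Z) (c * (a k / 2))))).
apply: eq_bigr => t _; congr (_ + _); rewrite addrC.
by congr (F _ _ + F _ _); ring.
Qed.

Lemma riesz_densityE N x :
  riesz_density a lam N x =
  \sum_(t <- riesz_terms N) t.2 * cos (2 * pi * t.1%:~R * x).
Proof.
elim: N => [|k IH].
  by rewrite /riesz_density big_ord0 big_seq1 /= mulr0 mul0r cos0 mulr1.
rewrite (sum_riesz_termsS (fun n c => c * cos (2 * pi * n%:~R * x))).
rewrite /riesz_density big_ord_recr /= -/(riesz_density a lam k x) IH mulr_suml.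
apply: eq_bigr => -[n c] _ /=.
have -> : 2 * pi * (n + (lam k)%:Z)%:~R * x =
    2 * pi * n%:~R * x + 2 * pi * (lam k)%:R * x by rewrite intrD; ring.
have -> : 2 * pi * (n - (lam k)%:Z)%:~R * x =
    2 * pi * n%:~R * x - 2 * pi * (lam k)%:R * x by rewrite intrB; ring.
by rewrite cosD cosB; field.
Qed.

(** A coefficient c has the children c, c a_k / 2 and c a_k / 2, so each level multiplies the l^p
    mass by 1 + 2 |a_k / 2|^p. *)
Lemma sum_riesz_terms_powR p N :
  \sum_(t <- riesz_terms N) `|t.2| `^ p =
  \prod_(j < N) (1 + `|a j| `^ p * 2 `^ (1 - p)).
Proof.
elim: N => [|k IH]; first by rewrite big_ord0 big_seq1 /= normr1 powR1.
rewrite (sum_riesz_termsS (fun n c => `|c| `^ p)) big_ord_recr /= -IH mulr_suml.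
apply: eq_bigr => t _; rewrite mulrDr mulr1; congr (_ + _).
have -> : `|t.2 * (a k / 2)| = `|t.2| * (`|a k| * 2^-1).
  by rewrite !normrM normfV (ger0_norm (ler0n R 2)).
rewrite (_ : forall x : R, x + x = 2 * x) => [|x]; last by ring.
rewrite [(`|t.2| * _) `^ p]powRM ?mulr_ge0 ?invr_ge0 // powRM ?invr_ge0 // -(powR_inv1 (ler0n R
    2)) -powRrM mulN1r.
by rewrite powRD ?pnatr_eq0 ?implybT // powRr1 //; ring.
Qed.

(** The ratio 3 closes the induction: twice the modulus of a translated frequency is below [lam k]
    plus twice [lam k]. *)
Lemma mem_riesz_terms_norm_le t N : t \in riesz_terms N -> (`|t.1|.*2 < lam N)%N.
Proof.
elim: N t => [|k IH] t /=; first by rewrite mem_seq1 => /eqP ->; exact: lam_pos.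
have := lam_lacunary k; rewrite !mem_cat => lk.
move=> /or3P[/IH|/mapP[[n c] /IH /= h ->]|/mapP[[n c] /IH /= h ->]] /=.
- by move: (lam_pos k); lia.
- by move: (lam_pos k); lia.
- by move: (lam_pos k); lia.
Qed.

(** Old frequencies have modulus below half of [lam k], and the translated ones lie beyond that on
    either side, so the three blocks are disjoint. *)
Lemma uniq_riesz_terms N : uniq [seq t.1 | t <- riesz_terms N].
Proof.
elim: N => [//|k IH]; rewrite /= !map_cat -!map_comp.
set s := riesz_terms k.
have eD (e : int) : [seq (fst \o (fun t : int * R => (t.1 + e, t.2 * (a k / 2)))) t | t <- s] =
    [seq n + e | n <- [seq t.1 | t <- s]] by rewrite -map_comp.
rewrite !eD !cat_uniq !(map_inj_uniq (@addIr _ _)) IH.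
have bnd n : n \in [seq t.1 | t <- s] -> (`|n|.*2 < lam k)%N.
  by move=> /mapP[t ts ->]; exact: mem_riesz_terms_norm_le.
apply/and5P; split => //; apply/hasPn => n.
- rewrite mem_cat => /orP[] /mapP[m ms ->]; apply/negP => /bnd.
    by move: (bnd _ ms) (lam_pos k); lia.
  by move: (bnd _ ms) (lam_pos k); lia.
- move=> /mapP[m ms ->]; apply/negP => /mapP[q qs e].
  by move: (bnd _ ms) (bnd _ qs) (lam_pos k) e; lia.
Qed.

Lemma riesz_terms0 k : (0, 1) \in riesz_terms k.
Proof. by elim: k => [|k IH] /=; rewrite ?mem_cat ?IH // mem_seq1. Qed.

Lemma mem_riesz_terms_lam k : ((lam k)%:Z, a k / 2) \in riesz_terms k.+1.
Proof.
rewrite /= !mem_cat; apply/or3P; apply: Or32; apply/mapP.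
by exists (0, 1); rewrite ?riesz_terms0 //= add0r mul1r.
Qed.

Lemma mem_riesz_terms_mono t N m : (N <= m)%N ->
  t \in riesz_terms N -> t \in riesz_terms m.
Proof.
move=> /subnKC <- tN; elim: (m - N)%N => [|d IH]; rewrite ?addn0 //.
by rewrite addnS /= mem_cat IH.
Qed.

Lemma expn3_le_lam k : (3 ^ k <= lam k)%N.
Proof.
elim: k => [|k IH]; first by rewrite expn0 lam_pos.
by rewrite expnS (leq_trans _ (lam_lacunary k)) // leq_mul2l.
Qed.

Lemma sum_riesz_terms_jb_le (d z : R) N : 0 < d ->
  \sum_(t <- riesz_terms N) jb (z - t.1%:~R) `^ (- (1 + d)) <=
  2 `^ (1 + d) * (2 * (1 + d^-1)).
Proof.
move=> d0; rewrite -(big_map fst xpredT (fun n : int => jb (z - n%:~R) `^ (- (1 + d)))).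
exact/sum_jb_int_le/uniq_riesz_terms.
Qed.

End RieszTerms.

(** * Integrals of powers on the line *)

Section LebesgueIntegrals.
Context {R : realType}.
Notation leb := (@lebesgue_measure R).
Implicit Types (a b c e : R) (G : R -> R).

Lemma measurable_EFin_continuous G (D : set R) : continuous G ->
  measurable_fun D (EFin \o G).
Proof.
move=> cG; apply/measurable_EFinP; apply: measurable_funTS.
exact: continuous_measurable_fun.
Qed.

Lemma ge0_integral_affine G a b : 0 < a -> continuous G -> (forall x, 0 <= G x) ->
  (\int[leb]_x (G (a * (x - b)) * a)%:E = \int[leb]_x (G x)%:E)%E.
Proof.
move=> a0 cG G0; pose F x : R := a * (x - b).
have dF (x : R) : is_derive x 1 F a.
  have := @is_deriveZ _ _ _ (fun x => x - b) a x 1 1 _.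
  rewrite /GRing.scale /= mulr1; apply.
  by have := @is_deriveB _ _ _ id (cst b) x 1 1 0 _ _; rewrite subr0; apply.
have F'E : F^`()%classic = cst a by apply/funext => x; rewrite derive1E; exact: derive_val.
rewrite [RHS](@increasing_ge0_integration_by_substitutionT _ F).
- by apply: eq_integral => x _; rewrite F'E.
- by move=> x y xy; rewrite ltr_pM2l // ltrD2r.
- by rewrite F'E; move=> x; exact: cvg_cst.
- by rewrite F'E; exact: is_cvg_cst.
- by rewrite F'E; exact: is_cvg_cst.
- by move=> x; exact: ex_derive.
- apply/cvgrNyPle => A; near=> x; rewrite /F mulrC -ler_pdivlMr // lerBlDr.
  by near: x; apply: nbhs_ninfty_le; exact: num_real.
- apply/cvgryPge => A; near=> x; rewrite /F mulrC -ler_pdivrMr // lerBrDr.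
  by near: x; apply: nbhs_pinfty_ge; exact: num_real.
- exact: cG.
- exact: G0.
Unshelve. all: by end_near. Qed.

Lemma ge0_integral_translate G b : continuous G -> (forall x, 0 <= G x) ->
  (\int[leb]_x (G (x - b))%:E = \int[leb]_x (G x)%:E)%E.
Proof.
move=> cG G0; rewrite -(ge0_integral_affine b ltr01 cG G0).
by apply: eq_integral => x _; rewrite mul1r mulr1.
Qed.

Lemma measurable_fun_powR (f : R -> R) p : measurable_fun [set: R] f ->
  measurable_fun [set: R] (fun x => f x `^ p).
Proof. exact: (measurableT_comp (measurable_powR p)). Qed.

(** Continuous counterpart of [jensen_sum], with the same tangent at [y = X / W]. The integral of
    p-th powers may be infinite, hence the extended reals. *)
Lemma jensen_integral (w b : R -> R) p X W : 1 < p -> 0 < W -> 0 <= X ->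
  (forall z, 0 <= w z) -> (forall z, 0 <= b z) ->
  measurable_fun [set: R] w -> measurable_fun [set: R] b ->
  (\int[leb]_z (w z)%:E = W%:E)%E ->
  (X%:E <= \int[leb]_z (w z * b z)%:E)%E ->
  ((X `^ p)%:E <= (W `^ (p - 1))%:E * \int[leb]_z (w z * b z `^ p)%:E)%E.
Proof.
move=> p1 W0 X0 w0 b0 mw mb wW Xwb; set S := (\int[leb]_z (_ * _ `^ _)%:E)%E.
set y := X / W; have y0 : 0 <= y by rewrite divr_ge0 // ltW.
have XE : X = y * W by rewrite /y divfK // gt_eqF.
have mwb : measurable_fun [set: R] (EFin \o (fun z => w z * b z)).
  exact/measurable_EFinP/measurable_funM.
have mwbp : measurable_fun [set: R] (EFin \o (fun z => w z * b z `^ p)).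
  by apply/measurable_EFinP/measurable_funM => //; exact: measurable_fun_powR.
have c0 : 0 <= p * y `^ (p - 1) by rewrite mulr_ge0 ?powR_ge0 //; lra.
have d0 : 0 <= (p - 1) * y `^ p by rewrite mulr_ge0 ?powR_ge0 //; lra.
have H : ((p * y `^ (p - 1))%:E * X%:E <= S + ((p - 1) * y `^ p * W)%:E)%E.
  apply: le_trans (lee_wpmul2l _ Xwb) _; first by rewrite lee_fin.
  rewrite -ge0_integralZl_EFin //; last by move=> z _; rewrite lee_fin mulr_ge0.
  rewrite EFinM -wW -ge0_integralZl_EFin //; first last.
  - exact/measurable_EFinP.
  - by move=> z _; rewrite lee_fin.
  rewrite -ge0_integralD //; first last.
  - by apply: measurable_funeM; exact/measurable_EFinP.
  - by move=> z _; rewrite -EFinM lee_fin mulr_ge0.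
  - by move=> z _; rewrite lee_fin mulr_ge0 ?powR_ge0.
  apply: ge0_le_integral => //.
  - by move=> z _; rewrite -EFinM lee_fin; apply: mulr_ge0 => //; exact: mulr_ge0.
  - exact: measurable_funeM.
  - by apply: emeasurable_funD => //; apply: measurable_funeM; exact/measurable_EFinP.
  - move=> z _; rewrite -!EFinM -EFinD lee_fin.
    have := ler_wpM2l (w0 z) (powR_tangent_ge p1 (b0 z) y0); lra.
have yp : y * y `^ (p - 1) = y `^ p by rewrite mulr_powRB1 //; lra.
have {}H : ((W * y `^ p)%:E <= S)%E.
  move: H; rewrite -EFinM -leeBlDr // -EFinB; apply: le_trans.
  rewrite lee_fin XE (_ : p * _ * _ = p * (y * y `^ (p - 1)) * W); last by ring.
  rewrite yp; lra.
apply: le_trans (lee_wpmul2l _ H); last by rewrite lee_fin powR_ge0.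
rewrite -EFinM lee_fin XE powRM // ?(ltW W0) // -[in W `^ p](mulr_powRB1 (ltW W0)); last by lra.
by rewrite mulrC -mulrA mulrCA.
Qed.

Lemma continuous_jb_powR e : continuous (fun z : R => jb z `^ e).
Proof.
move=> z; rewrite /jb /powR.
under eq_fun => x do rewrite gt_eqF ?jb_gt0 //.
apply: (@continuous_comp _ _ _ (fun x : R => e * ln (1 + `|x|)) expR);
    last exact: continuous_expR.
apply: continuousM; first exact: cst_continuous.
apply: (@continuous_comp _ _ _ (fun x : R => 1 + `|x|) (@ln R)); last first.
  exact/continuous_ln/jb_gt0.
apply: continuousD; first exact: cst_continuous.
exact: norm_continuous.
Qed.

Lemma integral_jb_powRN k : 1 < k ->
  (\int[leb]_x (jb x `^ (- k))%:E = (2 / (k - 1))%:E)%E.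
Proof.
move=> k1; have k10 : 0 < k - 1 by rewrite subr_gt0.
rewrite ge0_symfun_integralT; first last.
- by move=> x /=; rewrite jbN.
- exact: continuous_jb_powR.
- by move=> x; exact: powR_ge0.
rewrite -set_itvcy.
pose F x : R := - (k - 1)^-1 * (1 + x) `^ (1 - k).
have dF (x : R) : 0 <= x -> is_derive x 1 F ((1 + x) `^ (- k)).
  move=> x0; have x1 : 0 < 1 + x by rewrite ltr_wpDr.
  have H := @is_derive1_comp _ (fun y : R => - (k - 1)^-1 * y `^ (1 - k)) (fun x : R => 1 + x) x
      ((1 + x) `^ (- k)) 1.
  rewrite -[(1 + x) `^ _]mulr1; apply: H; last first.
    by have := @is_deriveD _ _ _ (cst (1 : R)) id x 1 0 1 _ _; rewrite add0r; apply.
  have -> : (1 + x) `^ (- k) = - (k - 1)^-1 *: ((1 - k) * (1 + x) `^ (1 - k - 1)).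
    rewrite /GRing.scale /= mulrA (_ : 1 - k - 1 = - k); last by ring.
    by rewrite -[1 - k]opprB mulrNN mulVf ?mul1r // gt_eqF.
  by apply: is_deriveZ; exact: is_derive1_powR.
rewrite (_ : (\int[leb]_(x in _) _ = \int[leb]_(x in `[0%R, +oo[) ((1 + x) `^ (- k))%:E)%E);
    last first.
  by apply: eq_integral => x; rewrite inE /= in_itv /= andbT /jb => x0; rewrite ger0_norm.
have cF (x : R) : 0 <= x -> {for x, continuous F}.
  move=> x0; apply/differentiable_continuous/derivable1_diffP.
  by have := dF _ x0 => -[].
rewrite (@ge0_continuous_FTC2y _ _ F 0 0).
- by rewrite /F addr0 powR1 mulr1 -EFinB sub0r opprK -EFinM.
- by move=> x x0; exact: powR_ge0.
- apply: (@subspace_eq_continuous _ _ _ (fun x => jb x `^ (- k))).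
    by move=> x; rewrite inE /= in_itv /= andbT /jb => x0; rewrite ger0_norm.
  exact/continuous_subspaceT/continuous_jb_powR.
- rewrite -[X in _ --> X](mulr0 (- (k - 1)^-1)); apply: cvgM; first exact: cvg_cst.
  apply/cvgr0Pnorm_le => d d0; near=> x.
  have dx : d `^ (- (k - 1)^-1) <= 1 + x.
    rewrite -lerBlDl; near: x; apply: nbhs_pinfty_ge; exact: num_real.
  rewrite ger0_norm ?powR_ge0 // -[1 - k]opprB.
  apply: le_trans (ler_powRN (powR_gt0 _ d0) dx (ltW k10)) _.
  by rewrite -powRrM mulrNN mulVf ?gt_eqF // powRr1 // ltW.
- by move=> x x0; have := dF x (ltW x0) => -[].
- exact/cvg_at_right_filter/cF.
- move=> x; rewrite in_itv /= andbT => x0; rewrite derive1E.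
  by have := dF x (ltW x0) => H; exact: derive_val.
Unshelve. all: by end_near. Qed.

Lemma continuous_norm_powR p : 0 < p -> continuous (fun x : R => `|x| `^ p).
Proof.
move=> p0 x; have [->|x0] := eqVneq x 0; last first.
  apply: (@continuous_comp _ _ _ (@Num.norm _ R) (fun y : R => y `^ p)).
    exact: norm_continuous.
  apply/differentiable_continuous/derivable1_diffP.
  have nx0 : 0 < `|x| by rewrite normr_gt0.
  by have := is_derive1_powR p nx0 => -[].
rewrite /continuous_at normr0 powR0 ?gt_eqF //; apply/cvgr0Pnorm_le => d d0.
near=> y; rewrite ger0_norm ?powR_ge0 //.
have : `|y| <= d `^ p^-1.
  by near: y; apply: (@cvgr0_norm_le _ _ _ _ _ id); [exact: cvg_id|rewrite powR_gt0].
move=> /(ge0_ler_powR (ltW p0)); rewrite !nnegrE powR_ge0 normr_ge0 => /(_ isT isT).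
by rewrite -powRrM mulVf ?gt_eqF // powRr1 // ltW.
Unshelve. all: by end_near. Qed.

Lemma continuous_translate G b : continuous G -> continuous (fun z => G (z - b)).
Proof.
move=> cG z; apply: (@continuous_comp _ _ _ (fun z => z - b) G); last exact: cG.
by apply: cvgB; [exact: cvg_id|exact: cvg_cst].
Qed.

Lemma integral_jb_powRN_translate A k b : 0 <= A -> 1 < k ->
  (\int[leb]_x (A * jb (x - b) `^ (- k))%:E = (A * (2 / (k - 1)))%:E)%E.
Proof.
move=> A0 k1; have cj := @continuous_jb_powR (- k).
under eq_integral do rewrite EFinM.
rewrite ge0_integralZl_EFin //; first last.
- exact: measurable_EFin_continuous (continuous_translate cj).
- by move=> x _; rewrite lee_fin powR_ge0.
rewrite (ge0_integral_translate _ cj) ?integral_jb_powRN // => x.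
exact: powR_ge0.
Qed.

Lemma geometric_sum_le (r : R) n : 0 <= r < 1 -> \sum_(0 <= k < n) r ^+ k <= (1 - r)^-1.
Proof.
move=> /andP[r0 r1]; rewrite big_mkord -[X in _ <= X]mul1r ler_pdivlMr ?subr_gt0 // mulrC.
have := subrX1 r n => /(congr1 (@GRing.opp R)); rewrite -mulNr !opprB => <-.
by rewrite gerBl exprn_ge0.
Qed.

Lemma geometric_nneseries_lty c r : 0 <= c -> 0 <= r < 1 ->
  (\sum_(0 <= n <oo) (c * r ^+ n)%:E < +oo)%E.
Proof.
move=> c0 r01; have /andP[r0 _] := r01.
apply: (@le_lt_trans _ _ (c / (1 - r))%:E); last exact: ltry.
apply: lime_le.
  by apply: is_cvg_nneseries => n _ _; rewrite lee_fin mulr_ge0 ?exprn_ge0.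
by near=> n; rewrite sumEFin lee_fin -mulr_sumr ler_wpM2l // geometric_sum_le.
Unshelve. all: by end_near. Qed.

(** Dyadic domination: |x|^-e is at most the sum over n of 2^(e(n+1)) times the indicator of |x| <=
    2^-n, and the integrals form a geometric series of ratio 2^e / 2 < 1. *)
Lemma integral_powRN_lty e : 0 < e < 1 ->
  (\int[leb]_(x in `[(-1)%R, 1%R]) (`|x| `^ (- e))%:E < +oo)%E.
Proof.
move=> /andP[e0 e1].
pose B n : set R := [set` `[- ((2^-1 : R) ^+ n), 2^-1 ^+ n]].
pose f n (x : R) : R := (2 `^ e) ^+ n.+1 * \1_(B n) x.
have f0 n x : 0 <= f n x by rewrite mulr_ge0 ?exprn_ge0 ?powR_ge0.
have sf0 x : (0 <= \sum_(0 <= n <oo) (f n x)%:E)%E.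
  by apply: nneseries_ge0 => n _ _; rewrite lee_fin.
have mf n : measurable_fun [set: R] (f n).
  by apply: measurable_funM; [exact: measurable_cst|apply: measurable_indic;
      exact: measurable_itv].
have mE : measurable_fun [set: R] (fun x : R => `|x| `^ (- e)).
  exact: (measurableT_comp (measurable_powR (- e)) (@normr_measurable R setT)).
apply: (@le_lt_trans _ _ (\int[leb]_x \sum_(0 <= n <oo) (f n x)%:E)%E).
  rewrite integral_mkcond; apply: ge0_le_integral => //.
  - by move=> x _; rewrite patchE; case: ifP; rewrite // lee_fin powR_ge0.
  - apply/measurable_restrict => //; apply/measurable_EFinP.
    exact: measurable_funTS.
  - apply: (@ge0_emeasurable_sum _ _ _ _ (fun n x => (f n x)%:E) xpredT).
      by move=> n x _ _; rewrite lee_fin.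
    by move=> n _; exact/measurable_EFinP.
  - move=> x _; rewrite patchE; case: ifPn => [|_]; last exact: sf0.
    rewrite inE /= in_itv /= -ler_norml => x1.
    (* [powR] sends 0 to 0 for a nonzero exponent, so the origin is harmless. *)
    have [->|x0] := eqVneq x 0.
      by rewrite normr0 powR0 ?oppr_eq0 ?gt_eqF //; exact: sf0.
    have nx0 : 0 < `|x| by rewrite normr_gt0.
    have ex : exists n, 2^-1 ^+ n.+1 < `|x|.
      exists (Num.truncn `|x|^-1); rewrite exprVn.
      rewrite -[X in _ < X]invrK ltf_pV2 ?posrE ?invr_gt0 ?exprn_gt0 //.
      apply: lt_trans (truncnS_gt _) _.
      by rewrite -natrX ltr_nat ltn_expl.
    (* Minimality gives |x| <= 2^-n as well, so the single term n already dominates. *)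
    case: (ex_minnP ex) => n nx nmin.
    have xn : `|x| <= 2^-1 ^+ n.
      case: n nx nmin => [|n] nx nmin; first by rewrite expr0.
      by rewrite leNgt; apply/negP => /nmin; rewrite ltnn.
    apply: le_trans (_ : (f n x)%:E <= _)%E; last first.
      apply: le_trans (nneseries_lim_ge n.+1 _) => [|k _ _]; last by rewrite lee_fin.
      by rewrite big_nat_recr //= leeDr // sume_ge0 // => k _; rewrite lee_fin.
    rewrite lee_fin /f indicE mem_set /=; last by rewrite /B /= in_itv /= -ler_norml.
    rewrite mulr1 -[in leRHS]powR_mulrn ?powR_ge0 // powRAC powR_mulrn //.
    apply: le_trans (ler_powRN _ (ltW nx) (ltW e0)) _; first by rewrite exprn_gt0.
    by rewrite exprVn -powR_inv1 ?exprn_ge0 // -powRrM mulrNN mul1r.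
have emf n : measurable_fun [set: R] (fun x => (f n x)%:E).
  exact: ((measurable_EFinP setT (f n)).2 (mf n)).
rewrite (@integral_nneseries _ _ _ leb setT measurableT _ emf); last first.
  by move=> n x _; rewrite lee_fin.
apply: le_lt_trans (_ : (\sum_(0 <= n <oo) ((2 `^ e * 2) * (2 `^ e / 2) ^+ n)%:E < +oo)%E).
  apply: lee_nneseries => n _.
    by move=> _; apply: integral_ge0 => x _; rewrite lee_fin.
  rewrite (_ : (\int[leb]_x (f n x)%:E)%E =
      ((2 `^ e) ^+ n.+1 * (2^-1 ^+ n + 2^-1 ^+ n))%:E) ?lee_fin.
    by rewrite exprS exprMn le_eqVlt; apply/orP; left; apply/eqP; ring.
  rewrite /f; under eq_integral do rewrite EFinM.
  rewrite ge0_integralZl_EFin ?exprn_ge0 ?powR_ge0 //; last first.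
    by apply/measurable_EFinP; apply: measurable_indic; exact: measurable_itv.
  rewrite integral_indic //; last exact: measurable_itv.
  rewrite setIT /B /= lebesgue_measure_itv /= lte_fin -subr_gt0 opprK.
  by rewrite addr_gt0 ?exprn_gt0 // -EFinD EFinM.
apply: geometric_nneseries_lty; first by rewrite mulr_ge0 ?powR_ge0.
rewrite divr_ge0 ?powR_ge0 //= ltr_pdivrMr // mul1r.
rewrite -[X in _ < X](powRr1 (ler0n R 2)) /powR pnatr_eq0 /= ltr_expR ltr_pM2r //.
by rewrite ln_gt0 // ltr1n.
Qed.
End LebesgueIntegrals.

(** * The reproducing kernel *)

Section TrapezoidKernel.
Context {R : realType}.
Notation leb := (@lebesgue_measure R).
Implicit Types (a b c e u x y z : R).

Lemma ler_norm_sin x : `|sin x| <= `|x|.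
Proof.
wlog x0 : x / 0 <= x.
  move=> H; have [/H//|x0] := leP 0 x.
  by rewrite -normrN -sinN -(normrN x) H // oppr_ge0 ltW.
have [c _] : exists2 c, c \in `[0, x] & sin x - sin 0 = cos c * (x - 0).
  apply: MVT_segment => //.
  exact/continuous_subspaceT/continuous_sin.
rewrite sin0 !subr0 => ->; rewrite normrM -[X in _ <= X]mul1r ler_wpM2r //.
exact: cos_max.
Qed.

Definition sinc x : R := if x == 0 then 1 else sin x / x.

Lemma sinc_mul x : sinc x * x = sin x.
Proof. by rewrite /sinc; case: eqP => [->|/eqP ?]; rewrite ?mulr0 ?sin0 // divfK. Qed.

Lemma norm_sinc_le1 x : `|sinc x| <= 1.
Proof.
rewrite /sinc; case: eqP => [_|/eqP x0]; first by rewrite normr1.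
by rewrite normf_div ler_pdivrMr ?normr_gt0 // mul1r ler_norm_sin.
Qed.

Lemma continuous_sinc : continuous sinc.
Proof.
move=> x; have [->|x0] := eqVneq x 0; last first.
  apply: (@cvg_trans _ ((fun y : R => sin y / y) @ x)).
    apply: near_eq_cvg; near=> y; rewrite /sinc ifF //; apply/negbTE.
    by near: y; apply: cvgr_neq0 x0; exact: cvg_id.
  have -> : sinc x = sin x / x by rewrite /sinc (negbTE x0).
  have H : sin y / y @[y --> (x : R)] --> (sin x / x : R).
    by apply: cvgM; [exact: continuous_sin|apply: cvgV => //; exact: cvg_id].
  exact: H.
apply/continuous_withinNx; rewrite /sinc eqxx.
have d0 : (h^-1 *: (sin (h *: 1 + 0) - sin 0)) @[h --> (0:R)^'] --> (1 : R).
  have := @derivable_sin R 0; rewrite /derivable => H.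
  have E : 'D_1 (@sin R) 0 = 1 by rewrite (@derive_val _ _ _ _ _ _ _ (is_derive_sin 0)) cos0.
  by rewrite -[X in _ --> X]E; exact: H.
apply: cvg_trans d0; apply: near_eq_cvg; near=> h.
rewrite ifF; last by apply/negbTE; near: h; exact: nbhs_dnbhs_neq.
by rewrite sin0 addr0 subr0 /GRing.scale /= mulr1 mulrC.
Unshelve. all: by end_near. Qed.

(* [(1 - cos x) / x ^+ 2], written so as to be continuous at [0]. *)
Definition cosq x : R := sinc (x / 2) ^+ 2 / 2.

Lemma cosq_mul x : cosq x * x ^+ 2 = 1 - cos x.
Proof.
rewrite (_ : cos x = cos ((x / 2) *+ 2)); last by congr cos; rewrite -mulr_natr; field.
rewrite cos_mulr2n cos2sin2 -sinc_mul /cosq; field => //.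
Qed.

Lemma cosq_ge0 x : 0 <= cosq x.
Proof. by rewrite divr_ge0 // sqr_ge0. Qed.

Lemma cosq0 : cosq 0 = 1 / 2.
Proof. by rewrite /cosq mul0r /sinc eqxx expr1n. Qed.

Lemma continuous_cosq : continuous cosq.
Proof.
move=> x; rewrite /cosq; apply: cvgM; last exact: cvg_cst.
apply: (@continuous_comp _ _ _ (fun x => sinc (x / 2)) (fun y => y ^+ 2));
    last exact: exprn_continuous.
apply: (@continuous_comp _ _ _ (fun x => x / 2) sinc); last exact: continuous_sinc.
by apply: cvgM; [exact: cvg_id|exact: cvg_cst].
Qed.

(** From cosq <= 1/2, x^2 cosq <= 2 and <x>^2 <= 2 + 2 x^2, whence 5 = 1 + 4. *)
Lemma cosq_le x : cosq x <= 5 * jb x `^ (- 2).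
Proof.
rewrite powRN powR_mulrn ?(ltW (jb_gt0 _)) // ler_pdivlMr ?exprn_gt0 ?jb_gt0 //.
have h1 : cosq x <= 1 / 2.
  by rewrite ler_pM2r // -[sinc _ ^+ 2]ger0_norm ?sqr_ge0 // normrX exprn_ile1 // norm_sinc_le1.
have h2 : cosq x * x ^+ 2 <= 2 by rewrite cosq_mul; have := cos_geN1 x; lra.
have h3 : jb x ^+ 2 <= 2 + 2 * x ^+ 2.
  rewrite /jb -[x ^+ 2]ger0_norm ?sqr_ge0 // normrX.
  have -> : (1 + `|x|) ^+ 2 = 2 + 2 * `|x| ^+ 2 - (1 - `|x|) ^+ 2 by ring.
  by rewrite gerBl sqr_ge0.
apply: le_trans (ler_wpM2l (cosq_ge0 x) h3) _; lra.
Qed.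

Lemma integral_cosq_fin : (\int[leb]_x (cosq x)%:E)%E \is a fin_num.
Proof.
rewrite ge0_fin_numE; last by apply: integral_ge0 => x _; rewrite lee_fin cosq_ge0.
apply: (@le_lt_trans _ _ (\int[leb]_x (5 * jb x `^ (- 2))%:E)%E).
  apply: ge0_le_integral => //.
  - by move=> x _; rewrite lee_fin cosq_ge0.
  - exact: measurable_EFin_continuous continuous_cosq.
  - apply: measurable_EFin_continuous => x; apply: cvgM; first exact: cvg_cst.
    exact: continuous_jb_powR.
  - by move=> x _; rewrite lee_fin cosq_le.
under eq_integral do rewrite EFinM.
rewrite ge0_integralZl_EFin //; first last.
- apply: measurable_EFin_continuous; exact: continuous_jb_powR.
- by move=> x _; rewrite lee_fin powR_ge0.
by rewrite integral_jb_powRN ?ltr1n // -EFinM ltry.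
Qed.

Definition cosq_int : R := fine (\int[leb]_x (cosq x)%:E)%E.

Lemma cosq_int_gt0 : 0 < cosq_int.
Proof.
rewrite -lte_fin fineK ?integral_cosq_fin //.
have : \forall x \near (0:R), 1 / 4 < cosq x.
  have := @continuous_cosq 0; rewrite /continuous_at cosq0 => /cvgrPdist_lt.
  move=> /(_ (1 / 4)); rewrite divr_gt0 // => /(_ isT); apply: filterS => x.
  by rewrite ltr_distlC => /andP[]; lra.
move=> /nbhs_ballP[d /= d0 dB].
have {}dB x : x \in `]- d, d[ -> 1 / 4 < cosq x.
  by rewrite in_itv /= -ltr_norml => xd; apply: dB; rewrite /ball /= sub0r normrN.
apply: lt_le_trans (_ : (0 < \int[leb]_(x in `](- d)%R, d[) cst (1 / 4)%:E x)%E) _.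
  rewrite integral_cst //= lebesgue_measure_itv /= lte_fin gtrN // -EFinB -EFinM lte_fin.
  by rewrite mulr_gt0 ?divr_gt0 // opprK addr_gt0.
apply: (@le_trans _ _ (\int[leb]_(x in `](- d)%R, d[) (cosq x)%:E)%E).
  apply: ge0_le_integral => //.
  - by move=> x _; rewrite lee_fin.
  - exact: measurable_EFin_continuous continuous_cosq.
  - by move=> x /dB; rewrite lee_fin => /ltW.
apply: ge0_subset_integral => //.
- exact: measurable_EFin_continuous continuous_cosq.
- by move=> x _; rewrite lee_fin cosq_ge0.
Qed.

Lemma sqr_cosq_ge0 a x : 0 <= a ^+ 2 * cosq x.
Proof. by apply: mulr_ge0; [exact: sqr_ge0|exact: cosq_ge0]. Qed.

(** Scaling. The case [a = 0] is included because 1/2 + y or 1/2 - y vanishes at the endpoints of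
    the recentred support of mu. *)
Lemma integral_cosq_affine a b : 0 <= a ->
  (\int[leb]_x (a ^+ 2 * cosq (a * (x - b)))%:E = (a * cosq_int)%:E)%E.
Proof.
rewrite le_eqVlt => /predU1P[<-|a0].
  by under eq_integral do rewrite expr0n mul0r; rewrite mul0r integral0.
under eq_integral => x _.
  have -> : a ^+ 2 * cosq (a * (x - b)) = a * (cosq (a * (x - b)) * a) by ring.
  rewrite EFinM; over.
have cc : continuous (fun x => cosq (a * (x - b)) * a).
  move=> x; apply: cvgM; last exact: cvg_cst.
  apply: (@continuous_comp _ _ _ (fun x => a * (x - b)) cosq); last exact: continuous_cosq.
  apply: cvgM; first exact: cvg_cst.
  by apply: cvgB; [exact: cvg_id|exact: cvg_cst].
rewrite ge0_integralZl_EFin ?(ltW a0) //; first last.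
- exact: measurable_EFin_continuous cc.
- by move=> x _; rewrite lee_fin mulr_ge0 ?cosq_ge0 // ltW.
rewrite (ge0_integral_affine b a0 continuous_cosq) ?EFinM ?fineK ?integral_cosq_fin //.
exact: cosq_ge0.
Qed.

(* By homogeneity the integral of [(1 - cos (a z)) / z ^+ 2] is proportional to [`|a|], and
   [`|y + 1| + `|y - 1| - `|y + 1/2| - `|y - 1/2|] is constant for [`|y| <= 1/2]. *)
Definition vpk u : R := (2 * pi) ^+ 2 * cosq (2 * pi * u) - pi ^+ 2 * cosq (pi * u).

Lemma vpk_le : exists2 A, 0 < A & forall u, `|vpk u| <= A * jb u `^ (- 2).
Proof.
have pi0 := pi_gt0 R; have pi2 := pi_ge2 R.
exists (5 * ((2 * pi) ^+ 2 + pi ^+ 2)); first by rewrite mulr_gt0 // addr_gt0 ?exprn_gt0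
    ?mulr_gt0.
move=> u; have key a : 1 <= a -> `|a ^+ 2 * cosq (a * u)| <= 5 * a ^+ 2 * jb u `^ (- 2).
  move=> a1; rewrite ger0_norm ?sqr_cosq_ge0 //.
  apply: le_trans (ler_wpM2l (sqr_ge0 _) (cosq_le _)) _.
  rewrite mulrCA -mulrA ler_pM2l // ler_wpM2l ?sqr_ge0 //.
  apply: ler_powRN => //; first exact: jb_gt0.
  by rewrite /jb lerD2l normrM ler_peMl // (le_trans a1) // ler_norm.
rewrite mulrDr mulrDl; apply: le_trans (ler_normB _ _) (lerD (key _ _) (key _ _)); lra.
Qed.

Lemma continuous_vpk : continuous vpk.
Proof.
have H c : continuous (fun u : R => c ^+ 2 * cosq (c * u)).
  move=> u; apply: cvgM; first exact: cvg_cst.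
  apply: (@continuous_comp _ _ _ (fun x => c * x) cosq); last exact: continuous_cosq.
  by apply: cvgM; [exact: cvg_cst|exact: cvg_id].
by move=> u; apply: cvgB; exact: H.
Qed.

(** Product-to-sum: the cosine shifts the scales 2 pi and pi of the kernel by 2 pi y both ways, and
    the constants in the four terms (1 - cos (a u)) / u^2 cancel. *)
Lemma vpk_cosE u y : 2 * (vpk u * cos (2 * pi * u * y)) =
  (2 * pi * (1 + y)) ^+ 2 * cosq (2 * pi * (1 + y) * u) +
  (2 * pi * (1 - y)) ^+ 2 * cosq (2 * pi * (1 - y) * u) -
  (2 * pi * (1 / 2 + y)) ^+ 2 * cosq (2 * pi * (1 / 2 + y) * u) -
  (2 * pi * (1 / 2 - y)) ^+ 2 * cosq (2 * pi * (1 / 2 - y) * u).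
Proof.
have [->|u0] := eqVneq u 0.
  by rewrite /vpk !mulr0 mul0r cos0 !cosq0; field.
have u20 : u ^+ 2 != 0 by rewrite expf_neq0.
apply: (mulIf u20); rewrite /vpk.
have E a : a ^+ 2 * cosq (a * u) = (1 - cos (a * u)) / u ^+ 2.
  by rewrite -cosq_mul exprMn; field.
rewrite !E.
have -> : 2 * pi * (1 + y) * u = 2 * pi * u + 2 * pi * u * y by ring.
have -> : 2 * pi * (1 - y) * u = 2 * pi * u - 2 * pi * u * y by ring.
have -> : 2 * pi * (1 / 2 + y) * u = pi * u + 2 * pi * u * y by field.
have -> : 2 * pi * (1 / 2 - y) * u = pi * u - 2 * pi * u * y by field.
by rewrite !cosB !cosD; field.
Qed.

(** For |y| <= 1/2 the four scales are nonnegative, so the integral is linear in them and y cancels: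
    half of 2 pi (2 - 1) is pi. *)
Lemma integral_vpk b y : `|y| <= 1 / 2 ->
  (\int[leb]_z (vpk (z - b) * cos (2 * pi * (z - b) * y)) = pi * cosq_int)%R.
Proof.
rewrite ler_norml => /andP[y1 y2].
have pi0 := pi_gt0 R.
pose h a z := a ^+ 2 * cosq (a * (z - b)).
have ih a : 0 <= a -> leb.-integrable setT (EFin \o h a).
  move=> a0; apply/integrableP; split.
    apply: measurable_EFin_continuous => x.
    apply: cvgM; first exact: cvg_cst.
    apply: (@continuous_comp _ _ _ (fun x => a * (x - b)) cosq); last exact: continuous_cosq.
    apply: cvgM; first exact: cvg_cst.
    by apply: cvgB; [exact: cvg_id|exact: cvg_cst].
  under eq_integral do rewrite /= ger0_norm ?sqr_cosq_ge0 //.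
  by rewrite integral_cosq_affine // ltry.
have Ih a : 0 <= a -> (\int[leb]_z h a z)%R = a * cosq_int.
  by move=> a0; rewrite /Rintegral integral_cosq_affine.
have p1 : 0 <= 2 * pi * (1 + y) by apply: mulr_ge0; [rewrite mulr_ge0 // ltW|lra].
have p2 : 0 <= 2 * pi * (1 - y) by apply: mulr_ge0; [rewrite mulr_ge0 // ltW|lra].
have p3 : 0 <= 2 * pi * (1 / 2 + y) by apply: mulr_ge0; [rewrite mulr_ge0 // ltW|lra].
have p4 : 0 <= 2 * pi * (1 / 2 - y) by apply: mulr_ge0; [rewrite mulr_ge0 // ltW|lra].
under eq_Rintegral => z _.
  have -> : vpk (z - b) * cos (2 * pi * (z - b) * y) =
    2^-1 * (h (2 * pi * (1 + y)) z + h (2 * pi * (1 - y)) z -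
      h (2 * pi * (1 / 2 + y)) z - h (2 * pi * (1 / 2 - y)) z).
    by rewrite /h -vpk_cosE mulKf.
  over.
rewrite RintegralZl //; last first.
  have I1 := integrableD measurableT (ih _ p1) (ih _ p2).
  exact: (integrableB measurableT (integrableB measurableT I1 (ih _ p3)) (ih _ p4)).
have I1 := integrableD measurableT (ih _ p1) (ih _ p2).
have I2 := integrableB measurableT I1 (ih _ p3).
rewrite (RintegralB measurableT I2 (ih _ p4)) (RintegralB measurableT I1 (ih _ p3)).
rewrite (RintegralD measurableT (ih _ p1) (ih _ p2)) !Ih //; field => //.
Qed.
End TrapezoidKernel.

(** * The Fourier transform of a finite measure *)

Section FourierTransform.
Context {R : realType}.
Notation leb := (@lebesgue_measure R).
Variable mu : {finite_measure set (measurableTypeR R) -> \bar R}.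
Implicit Types (x z n : R).

(** The real part of exp(-i phi) times the transform: phases 0 and pi/2 give its real and imaginary
    parts, which keeps the analysis real. *)
Definition fcos z phi : R := \int[mu]_x cos (2 * pi * z * x + phi).

Definition fnorm z : R := Normc.normc (fourier_transform mu z).

Definition mass : R := fine (mu setT).

Lemma mass_ge0 : 0 <= mass. Proof. exact: fine_ge0. Qed.

Lemma continuous_cos_affine c phi : continuous (fun x : R => cos (c * x + phi)).
Proof.
move=> x; apply: (@continuous_comp _ _ _ (fun x => c * x + phi) cos); last exact: continuous_cos.
apply: cvgD; last exact: cvg_cst.
by apply: cvgM; [exact: cvg_cst|exact: cvg_id].
Qed.

Lemma integrable_continuous_bounded (f : R -> R) : continuous f ->
  (forall x, `|f x| <= 1) -> mu.-integrable setT (EFin \o f).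
Proof.
move=> cf f1; apply: measurable_bounded_integrable => //.
- by rewrite -ge0_fin_numE ?fin_num_measure.
- exact: continuous_measurable_fun.
- exists 1; split; first exact: num_real.
  by move=> y y1 x _; exact: le_trans (f1 x) (ltW y1).
Qed.

Lemma integrable_cos_affine c phi :
  mu.-integrable setT (EFin \o (fun x : R => cos (c * x + phi))).
Proof.
by apply: integrable_continuous_bounded => [|x]; [exact: continuous_cos_affine|exact: cos_max].
Qed.

Lemma fcosE z phi : fcos z phi = cos phi * fcos z 0 + sin phi * fcos z (pi / 2).
Proof.
rewrite /fcos -!RintegralZl //; try exact: integrable_cos_affine.
rewrite -RintegralD //; first last.
- by have := integrableZl measurableT (sin phi) (integrable_cos_affine (2 * pi * z) (pi / 2)).
- by have := integrableZl measurableT (cos phi) (integrable_cos_affine (2 * pi * z) 0).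
apply: eq_Rintegral => x _.
by rewrite addr0 cosDpihalf cosD mulrN [cos phi * _]mulrC [sin phi * _]mulrC.
Qed.

Lemma fnormE z : fnorm z = Num.sqrt (fcos z 0 ^+ 2 + fcos z (pi / 2) ^+ 2).
Proof.
rewrite /fnorm /fourier_transform /Cintegral /Normc.normc /=.
congr (Num.sqrt (_ ^+ 2 + _ ^+ 2)); apply: eq_Rintegral => x _.
  by rewrite cosN addr0.
by rewrite sinN cosDpihalf.
Qed.

Lemma fnorm_ge0 z : 0 <= fnorm z. Proof. by rewrite fnormE sqrtr_ge0. Qed.

Lemma norm_fcos_le z phi : `|fcos z phi| <= fnorm z.
Proof.
rewrite fnormE fcosE -sqrtr_sqr ler_wsqrtr //.
set A := fcos z 0; set B := fcos z (pi / 2).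
have -> : A ^+ 2 + B ^+ 2 = (cos phi ^+ 2 + sin phi ^+ 2) * (A ^+ 2 + B ^+ 2).
  by rewrite cos2Dsin2 mul1r.
rewrite -subr_ge0 (_ : _ - _ = (cos phi * B - sin phi * A) ^+ 2) ?sqr_ge0 //.
ring.
Qed.

Lemma fnorm_le z : fnorm z <= `|fcos z 0| + `|fcos z (pi / 2)|.
Proof.
rewrite fnormE -[X in _ <= X]ger0_norm ?addr_ge0 // -sqrtr_sqr ler_wsqrtr //.
rewrite sqrrD -!normrX !(ger0_norm (sqr_ge0 _)) lerD2r lerDl mulrn_wge0 // mulr_ge0 //.
Qed.

Lemma norm_fcos_le_mass z phi : `|fcos z phi| <= mass.
Proof.
have i1 := integrable_cos_affine (2 * pi * z) phi.
apply: le_trans (le_normr_Rintegral measurableT i1) _.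
apply: (@le_trans _ _ (\int[mu]_x (cst 1 x))).
  apply: le_Rintegral => //.
  - by have := integrable_norm i1.
  - by apply: integrable_continuous_bounded => [|x]; [exact: cst_continuous|rewrite normr1].
  - by move=> x _; exact: cos_max.
by rewrite Rintegral_cst // mul1r.
Qed.

Lemma fnorm_le_mass z : fnorm z <= 2 * mass.
Proof.
apply: le_trans (fnorm_le z) _.
by have := norm_fcos_le_mass z 0; have := norm_fcos_le_mass z (pi / 2); lra.
Qed.

Lemma fcosNz z phi : fcos (- z) phi = fcos z (- phi).
Proof. by apply: eq_Rintegral => x _; rewrite -cosN; congr cos; ring. Qed.

Lemma fnormN z : fnorm (- z) = fnorm z.
Proof.
rewrite !fnormE !fcosNz oppr0; congr (Num.sqrt (_ + _)).
by rewrite fcosE sinN cosN cos_pihalf sin_pihalf mul0r add0r mulN1r sqrrN.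
Qed.

Lemma continuous_fcos phi : continuous (fun z => fcos z phi).
Proof.
move=> z; have zI : z \in [set` `]z - 1, z + 1[].
  by rewrite inE /= in_itv /=; apply/andP; split; lra.
apply: (@continuity_under_integral R _ _ mu (fun z x => cos (2 * pi * z * x + phi))
  setT measurableT (z - 1) (z + 1) _ _ (cst 1) _ _ z zI).
- by move=> y _; exact: integrable_cos_affine.
- apply: aeW => x _ y _.
  rewrite (_ : (fun _ => _) = (fun y => cos (2 * pi * x * y + phi))).
    exact: continuous_cos_affine.
  by apply/funext => t; congr cos; ring.
- by apply: integrable_continuous_bounded => [|x]; [exact: cst_continuous|rewrite normr1].
- by move=> y _; apply: aeW => x _; exact: cos_max.
Qed.

Lemma continuous_fnorm : continuous fnorm.
Proof.
rewrite (_ : fnorm = fun z => Num.sqrt (fcos z 0 ^+ 2 + fcos z (pi / 2) ^+ 2)); last first.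
  by apply/funext => z; rewrite fnormE.
move=> z; apply: (@continuous_comp _ _ _ (fun z => fcos z 0 ^+ 2 + fcos z (pi / 2) ^+ 2)
    Num.sqrt);
  last exact: sqrt_continuous.
apply: cvgD; apply: (@continuous_comp _ _ _ (fun z => fcos z _) (fun y => y ^+ 2)).
- exact: continuous_fcos.
- exact: exprn_continuous.
- exact: continuous_fcos.
- exact: exprn_continuous.
Qed.

End FourierTransform.

(** * Sampling inequality *)

Section Sampling.
Context {R : realType}.
Notation leb := (@lebesgue_measure R).
Variable mu : {finite_measure set (measurableTypeR R) -> \bar R}.
Hypothesis mu01 : mu (~` `[0, 1]) = 0%E.
Implicit Types (x z n : R).

Lemma Rintegral_supp01 (f : R -> R) : mu.-integrable setT (EFin \o f) ->
  \int[mu]_x f x = \int[mu]_(x in `[0, 1]) f x.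
Proof.
move=> mf; rewrite /Rintegral; congr fine.
rewrite (@negligible_integral _ _ _ mu setT (~` `[0, 1])) //; last exact: measurableC.
by rewrite setTD setCK.
Qed.

(** Integrated in [z], this is a constant times cos (2 pi n x) for x in [0, 1]; integrated in [x],
    it yields transforms at z and 2n - z. The shift by 1/2 centres the support of mu on the flat
    part of the trapezoid. *)
Let kern n (x z : R) : R := cos (2 * pi * n * x) * (vpk (z - n) * cos (2 * pi * (z - n) * (x - 1
    / 2))).

Let kernE n x z : kern n x z = vpk (z - n) *
  (2^-1 * (cos (2 * pi * z * x - pi * (z - n)) + cos (2 * pi * (2 * n - z) * x + pi * (z - n)))).
Proof.
rewrite /kern mulrCA; congr (_ * _).
have -> : 2 * pi * z * x - pi * (z - n) = 2 * pi * n * x + 2 * pi * (z - n) * (x - 1 / 2) by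
    field.
have -> : 2 * pi * (2 * n - z) * x + pi * (z - n) = 2 * pi * n * x - 2 * pi * (z - n) * (x - 1 /
    2) by field.
by rewrite cosB cosD; field.
Qed.

Let mkern n : measurable_fun [set: measurableTypeR R * measurableTypeR R]
  (fun u => kern n u.1 u.2).
Proof.
have cm (f : R -> R) : continuous f -> measurable_fun [set: measurableTypeR R] f.
  exact: continuous_measurable_fun.
apply: measurable_funM.
  apply: (@measurableT_comp _ _ _ _ _ _ (fun x : R => cos (2 * pi * n * x))) measurable_fst.
  apply: cm => x; apply: (@continuous_comp _ _ _ (fun x => 2 * pi * n * x) cos);
      last exact: continuous_cos.
  by apply: cvgM; [exact: cvg_cst|exact: cvg_id].
have mb : measurable_fun [set: measurableTypeR R * measurableTypeR R] (fun u => u.2 - n : R).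
  by apply: measurable_funB => //; exact: measurable_snd.
apply: measurable_funM.
  apply: (@measurableT_comp _ _ _ _ _ _ (vpk : R -> R)) mb.
  exact: continuous_measurable_fun (@continuous_vpk R).
apply: (@measurableT_comp _ _ _ _ _ _ (cos : R -> R));
    first exact: continuous_measurable_fun (@continuous_cos R).
apply: measurable_funM; first exact: measurable_funM.
by apply: measurable_funB => //; exact: measurable_fst.
Qed.

Lemma integrable_vpk_mul n (g : R -> R) : continuous g -> (forall z, `|g z| <= 1) ->
  leb.-integrable setT (EFin \o (fun z => vpk (z - n) * g z)).
Proof.
move=> cg g1; have [A A0 HA] := @vpk_le R.
have cF : continuous (fun z => vpk (z - n) * g z).
  by move=> z; apply: cvgM; [exact: continuous_translate (@continuous_vpk R) _|exact: cg].
apply/integrableP; split; first exact: measurable_EFin_continuous.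
apply: (@le_lt_trans _ _ (\int[leb]_z (A * jb (z - n) `^ (- 2))%:E)%E).
  apply: ge0_le_integral => //.
  - by apply: measurableT_comp => //; exact: measurable_EFin_continuous.
  - apply: measurable_EFin_continuous => z; apply: cvgM; first exact: cvg_cst.
    exact: (continuous_translate (@continuous_jb_powR R (- 2))).
  - move=> z _; rewrite /= lee_fin normrM -[X in _ <= X]mulr1.
    by rewrite ler_pM.
by rewrite integral_jb_powRN_translate ?ltr1n ?ltW // ltry.
Qed.

(* Since [vpk] is an inverse Fourier transform of a trapezoid equal to a constant on the
   support of [mu], convolution with it reproduces the transform of [mu]. *)
Lemma fcos_reproduce n : pi * cosq_int * fcos mu n 0 =
  \int[leb]_z (vpk (z - n) *
    (2^-1 * (fcos mu z (- (pi * (z - n))) + fcos mu (2 * n - z) (pi * (z - n))))).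
Proof.
have [A A0 HA] := @vpk_le R.
pose F (u : measurableTypeR R * measurableTypeR R) : \bar R := (kern n u.1 u.2)%:E.
have mF : measurable_fun setT F by exact: (measurable_EFinP setT (fun u : measurableTypeR R *
    measurableTypeR R => kern n u.1 u.2)).2 (mkern n).
have iF : (mu \x leb)%E.-integrable setT F.
  apply/(integrable12ltyP _ _ mF).
  apply: (@le_lt_trans _ _ (\int[mu]_x (cst (A * 2)%:E x))%E); last first.
    rewrite integral_cst //; apply: lte_mul_pinfty => //.
      by rewrite lee_fin mulr_ge0 // ltW.
    by rewrite -ge0_fin_numE ?fin_num_measure.
  apply: ge0_le_integral => //.
  - by move=> x _; exact: integral_ge0.
  - apply: (@measurable_fun_fubini_tonelli_F _ _ _ _ R _ (fun u => `|F u|%E)) => //.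
    exact: measurableT_comp.
  - move=> x _; have mz : measurable_fun [set: measurableTypeR R] (fun z => `|F (x, z)|%E).
      apply: measurableT_comp => //; exact: measurableT_comp mF (measurable_pair1 x).
    apply: (@le_trans _ _ (\int[leb]_z (A * jb (z - n) `^ (- 2))%:E)%E).
      apply: ge0_le_integral => //.
      + apply: measurable_EFin_continuous => z; apply: cvgM; first exact: cvg_cst.
        exact: (continuous_translate (@continuous_jb_powR R (- 2))).
      + move=> z _; rewrite /F /kern /= lee_fin !normrM -[X in _ <= X]mul1r.
        rewrite ler_pM ?mulr_ge0 ?cos_max //.
        by rewrite -[X in _ <= X]mulr1 ler_pM ?cos_max.
    have e1 : 2 - 1 = 1 :> R by ring.
    by rewrite integral_jb_powRN_translate ?ltr1n ?(ltW A0) //= e1 divr1.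
have FF := Fubini iF.
have step1 : (\int[mu]_x \int[leb]_z F (x, z) = (pi * cosq_int * fcos mu n 0)%:E)%E.
  rewrite (@negligible_integral _ _ _ mu setT (~` `[0, 1])) //; first last.
  - exact: integrable_fubini_F.
  - exact: measurableC.
  rewrite setTD setCK.
  under eq_integral => x.
    rewrite inE /= in_itv /= => /andP[x0 x1].
    have -> : (\int[leb]_z F (x, z) = (pi * cosq_int * cos (2 * pi * n * x + 0))%:E)%E.
      have ik : leb.-integrable setT (EFin \o
          (fun z => vpk (z - n) * cos (2 * pi * (z - n) * (x - 1 / 2)))).
        apply: integrable_vpk_mul => [|z]; last exact: cos_max.
        rewrite (_ : (fun _ => _) = fun z => cos (2 * pi * (x - 1 / 2) * z +
            - (2 * pi * n * (x - 1 / 2)))); first exact: continuous_cos_affine.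
        by apply/funext => z; congr cos; ring.
      rewrite -(@integral_vpk _ n (x - 1 / 2)); last by rewrite ler_norml; apply/andP; split; lra.
      rewrite mulrC EFinM /Rintegral fineK; last exact: integrable_fin_num.
      rewrite -integralZl // addr0.
      by apply: eq_integral => z _; rewrite /F /kern /= -EFinM.
    over.
  under eq_integral do rewrite EFinM.
  have ic := @integrable_cos_affine _ mu (2 * pi * n) 0.
  rewrite integralZl //; last exact: integrableS ic.
  have fin : (\int[mu]_(x in `[0%R, 1%R]) (cos (2 * pi * n * x + 0))%:E)%E \is a fin_num.
    by apply: integrable_fin_num => //; exact: integrableS ic.
  by rewrite -(fineK fin) -EFinM /fcos Rintegral_supp01.
have step2 : (\int[leb]_z \int[mu]_x F (x, z) = \int[leb]_z (vpk (z - n) *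
    (2^-1 * (fcos mu z (- (pi * (z - n))) + fcos mu (2 * n - z) (pi * (z - n)))))%:E)%E.
  apply: eq_integral => z _.
  have i1 := @integrable_cos_affine _ mu (2 * pi * z) (- (pi * (z - n))).
  have i2 := @integrable_cos_affine _ mu (2 * pi * (2 * n - z)) (pi * (z - n)).
  have i3 := integrableD measurableT i1 i2.
  rewrite /fcos -RintegralD // -RintegralZl // -RintegralZl //; last first.
    exact: (integrableZl measurableT _ i3).
  rewrite /Rintegral fineK; last first.
    apply: integrable_fin_num => //.
    exact: (integrableZl measurableT _ (integrableZl measurableT _ i3)).
  by apply: eq_integral => x _; rewrite /F /= kernE.
by rewrite /Rintegral -step2 -FF step1.
Qed.
Lemma abse_fine_le (x : \bar R) : (`|fine x|%:E <= `|x|)%E.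
Proof. by case: x => //= *; rewrite normr0 leey. Qed.

Lemma measurable_fnorm : measurable_fun [set: R] (fnorm mu).
Proof. exact: continuous_measurable_fun (@continuous_fnorm R mu). Qed.

Lemma continuous_fcos2 (u v : R -> R) : continuous u -> continuous v ->
  continuous (fun z => fcos mu (u z) (v z)).
Proof.
move=> cu cv; have cp (f g : R -> R) : continuous f -> continuous g -> continuous (fun z => g (f
    z)).
  by move=> cf cg z; apply: (@continuous_comp _ _ _ f g); [exact: cf|exact: cg].
rewrite (_ : (fun _ => _) = fun z => cos (v z) * fcos mu (u z) 0 + sin (v z) * fcos mu (u z) (pi
    / 2)).
  move=> z; apply: cvgD; apply: cvgM.
  - exact: cp cv (@continuous_cos R) z.
  - exact: cp cu (@continuous_fcos _ mu 0) z.
  - exact: cp cv (@continuous_sin R) z.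
  - exact: cp cu (@continuous_fcos _ mu (pi / 2)) z.
by apply/funext => z; rewrite fcosE.
Qed.

(** The reflected point 2n - z becomes z - 2n because |mu^| is even; a translation can then bring it
    around -n. *)
Lemma fcos_le_integral : exists2 A : R, 0 < A & forall n,
  ((pi * cosq_int * `|fcos mu n 0|)%:E <= \int[leb]_z (A * jb (z - n) `^ (- 2) *
    ((fnorm mu z + fnorm mu (z - 2 * n)) / 2))%:E)%E.
Proof.
have [A A0 HA] := @vpk_le R; exists A => // n.
have caff a b : continuous (fun z : R => a * z + b).
  by move=> z; apply: cvgD; [apply: cvgM; [exact: cvg_cst|exact: cvg_id]|exact: cvg_cst].
have cc : continuous (fun z => vpk (z - n) *
  (2^-1 * (fcos mu z (- (pi * (z - n))) + fcos mu (2 * n - z) (pi * (z - n))))).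
  move=> z; apply: cvgM; first exact: continuous_translate (@continuous_vpk R) _.
  apply: cvgM; first exact: cvg_cst.
  apply: cvgD.
    apply: (@continuous_fcos2 id (fun z => - (pi * (z - n)))).
      by move=> y; exact: cvg_id.
    rewrite (_ : (fun _ => _) = fun z => - pi * z + pi * n) //.
    by apply/funext => y; ring.
  apply: (@continuous_fcos2 (fun z => 2 * n - z) (fun z => pi * (z - n))).
    rewrite (_ : (fun _ => _) = fun z => - 1 * z + 2 * n) //.
    by apply/funext => y; ring.
  rewrite (_ : (fun _ => _) = fun z => pi * z - pi * n) //.
  by apply/funext => y; ring.
have pI0 : 0 <= pi * cosq_int :> R by rewrite mulr_ge0 ?pi_ge0 // ltW // cosq_int_gt0.
rewrite -[pi * cosq_int]ger0_norm // -normrM fcos_reproduce.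
apply: le_trans (abse_fine_le _) _.
apply: le_trans.
  by apply: le_abse_integral => //; exact: measurable_EFin_continuous cc.
apply: ge0_le_integral => //.
- by apply: measurableT_comp => //; exact: measurable_EFin_continuous cc.
- apply: measurable_EFin_continuous => z; apply: cvgM.
    apply: cvgM; first exact: cvg_cst.
    exact: (continuous_translate (@continuous_jb_powR R (- 2))).
  apply: cvgM; last exact: cvg_cst.
  apply: cvgD; first exact: continuous_fnorm.
  exact: (continuous_translate (@continuous_fnorm _ mu)).
- move=> z _; rewrite /= lee_fin normrM ler_pM //.
  rewrite normrM ger0_norm ?invr_ge0 // mulrC ler_pM2r ?invr_gt0 //.
  rewrite -(fnormN mu (z - _)) opprB.
  by apply: le_trans (ler_normD _ _) (lerD _ _); exact: norm_fcos_le.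
Qed.

(* A Plancherel-Polya type inequality: the transform at [n] is controlled by weighted
   [L^p] averages of the transform around [n] and [- n]. *)
Lemma fcos_powR_le p : 1 < p -> exists2 K : R, 0 < K & forall n,
  ((`|fcos mu n 0| `^ p)%:E <= K%:E * \int[leb]_z (fnorm mu z `^ p *
    (jb (z - n) `^ (- 2) + jb (z + n) `^ (- 2)))%:E)%E.
Proof.
move=> p1; have [A A0 HA] := fcos_le_integral; have p0 : 0 <= p by lra.
have e1 : 2 - 1 = 1 :> R by ring.
set q := pi * cosq_int : R; have q0 : 0 < q by rewrite mulr_gt0 ?pi_gt0 ?cosq_int_gt0.
have W0 : 0 < A * 2 by rewrite mulr_gt0.
exists (q `^ (- p) * ((A * 2) `^ (p - 1) * A)); first by rewrite !mulr_gt0 ?powR_gt0.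
move=> n; pose b z := (fnorm mu z + fnorm mu (z - 2 * n)) / 2.
have b0 z : 0 <= b z by rewrite divr_ge0 // addr_ge0 ?fnorm_ge0.
have cfn := @continuous_fnorm _ mu.
have mb : measurable_fun [set: R] b.
  apply: continuous_measurable_fun => z; apply: cvgM; last exact: cvg_cst.
  by apply: cvgD; [exact: cfn|exact: (continuous_translate cfn)].
have cj : continuous (fun z : R => jb z `^ (- 2)) := @continuous_jb_powR R (- 2).
have cjn (m : R) : continuous (fun z : R => jb (z - m) `^ (- 2)) := continuous_translate cj.
have mw : measurable_fun [set: R] (fun z : R => A * jb (z - n) `^ (- 2)).
  apply: continuous_measurable_fun => z; apply: cvgM; first exact: cvg_cst.
  exact: cjn.
have mfp (g : R -> R) : continuous g ->
    measurable_fun [set: R] (fun z => fnorm mu z `^ p * g z).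
  move=> cg; apply: measurable_funM; last exact: continuous_measurable_fun.
  exact: measurable_fun_powR measurable_fnorm.
have X0 : 0 <= q * `|fcos mu n 0| by rewrite mulr_ge0 // ltW.
have w0 z : 0 <= A * jb (z - n) `^ (- 2) by rewrite mulr_ge0 ?powR_ge0 // ltW.
have wW : (\int[leb]_z (A * jb (z - n) `^ (- 2))%:E = (A * 2)%:E)%E.
  by rewrite integral_jb_powRN_translate ?ltr1n ?(ltW A0) // e1 divr1.
have J := jensen_integral p1 W0 X0 w0 b0 mw mb wW (HA n).
(* A mean is at most the larger entry, so b^p is below the sum of both p-th powers; translating the
   second by 2n turns <z - n>^-2 into <z + n>^-2. *)
have I2 : (\int[leb]_z (A * jb (z - n) `^ (- 2) * b z `^ p)%:E <=
   A%:E * \int[leb]_z (fnorm mu z `^ p * (jb (z - n) `^ (- 2) + jb (z + n) `^ (- 2)))%:E)%E.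
  have cjN : continuous (fun z : R => jb (z + n) `^ (- 2)).
    by move=> z; have := cjn (- n) z; rewrite opprK.
  have cfp : continuous (fun z => fnorm mu z `^ p).
    rewrite (_ : (fun _ => _) = fun z => `|fnorm mu z| `^ p); last first.
      by apply/funext => z; rewrite ger0_norm // fnorm_ge0.
    move=> z; apply: (@continuous_comp _ _ _ (fnorm mu) (fun y : R => `|y| `^ p));
        first exact: cfn.
    by apply: continuous_norm_powR; lra.
  have cG : continuous (fun z => fnorm mu z `^ p * jb (z + n) `^ (- 2)).
    by move=> z; apply: cvgM; [exact: cfp|exact: cjN].
  have G0 z : 0 <= fnorm mu z `^ p * jb (z + n) `^ (- 2) by rewrite mulr_ge0 ?powR_ge0.
  under [X in (_ <= _ * X)%E]eq_integral do rewrite mulrDr EFinD.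
  rewrite ge0_integralD //; first last.
  - exact: measurable_EFin_continuous cG.
  - by move=> z _; rewrite lee_fin.
  - by apply/measurable_EFinP; exact: mfp.
  - by move=> z _; rewrite lee_fin mulr_ge0 ?powR_ge0.
  rewrite -(ge0_integral_translate (2 * n) cG G0) -ge0_integralD //; first last.
  - exact: measurable_EFin_continuous (continuous_translate cG).
  - by move=> z _; rewrite lee_fin.
  - by apply/measurable_EFinP; exact: mfp.
  - by move=> z _; rewrite lee_fin mulr_ge0 ?powR_ge0.
  rewrite -ge0_integralZl_EFin ?(ltW A0) //; first last.
  - apply: emeasurable_funD; last exact: measurable_EFin_continuous (continuous_translate cG).
    by apply/measurable_EFinP; exact: mfp.
  - by move=> z _; rewrite -EFinD lee_fin addr_ge0 // mulr_ge0 ?powR_ge0.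
  apply: ge0_le_integral => //.
  - by move=> z _; rewrite lee_fin mulr_ge0 ?powR_ge0.
  - by apply/measurable_EFinP; apply: measurable_funM => //; exact: measurable_fun_powR.
  - apply: measurable_funeM; apply: emeasurable_funD.
      by apply/measurable_EFinP; exact: mfp.
    exact: measurable_EFin_continuous (continuous_translate cG).
  - move=> z _; rewrite -EFinD -EFinM lee_fin -mulrA ler_pM2l //.
    have -> : z - 2 * n + n = z - n by ring.
    rewrite -mulrDl mulrC ler_wpM2r ?powR_ge0 //.
    have f1 := fnorm_ge0 mu z; have f2 := fnorm_ge0 mu (z - 2 * n).
    have [h|h] := leP (fnorm mu z) (fnorm mu (z - 2 * n)).
      apply: le_trans (_ : fnorm mu (z - 2 * n) `^ p <= _); last by rewrite lerDr powR_ge0.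
      by apply: ge0_ler_powR; rewrite ?nnegrE // /b; lra.
    apply: le_trans (_ : fnorm mu z `^ p <= _); last by rewrite lerDl powR_ge0.
    by apply: ge0_ler_powR; rewrite ?nnegrE // /b; lra.
have -> : `|fcos mu n 0| `^ p = q `^ (- p) * (q * `|fcos mu n 0|) `^ p.
  by rewrite powRM ?(ltW q0) // mulrA powRN mulVf ?mul1r // gt_eqF // powR_gt0.
rewrite !EFinM -muleA lee_pmul2l ?lte_fin ?powR_gt0 //.
apply: le_trans J _; rewrite -muleA lee_pmul2l ?lte_fin ?powR_gt0 //.
Qed.
End Sampling.

(** * The Fourier transform of the Riesz product *)

Section UnitIntegral.
Context {R : realType}.
Notation leb := (@lebesgue_measure R).
Implicit Types (z phi : R).

Lemma integrable_unit_continuous (f : R -> R) : continuous f ->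
  leb.-integrable `[0%R, 1%R] (EFin \o f).
Proof.
move=> cf; apply: continuous_compact_integrable; first exact: segment_compact.
exact: continuous_subspaceT.
Qed.

Definition unit_cos z phi : R := \int[leb]_(x in `[0, 1]) cos (2 * pi * z * x + phi).

Lemma unit_cosE z phi : z != 0 ->
  unit_cos z phi = (sin (2 * pi * z + phi) - sin phi) / (2 * pi * z).
Proof.
move=> z0; have pz0 : 2 * pi * z != 0 by rewrite !mulf_neq0 // gt_eqF // pi_gt0.
pose F x : R := (2 * pi * z)^-1 * sin (2 * pi * z * x + phi).
have dF (x : R) : is_derive x 1 F (cos (2 * pi * z * x + phi)).
  have Hc := @is_derive1_comp _ (@sin R) (fun x : R => 2 * pi * z * x + phi) x
    (cos (2 * pi * z * x + phi)) (2 * pi * z).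
  have -> : cos (2 * pi * z * x + phi) = (2 * pi * z)^-1 *: (cos (2 * pi * z * x + phi) * (2 *
      pi * z)).
    by rewrite /GRing.scale /= mulrCA mulVf ?mulr1.
  apply: is_deriveZ; apply: Hc.
  have H1 := @is_deriveZ _ _ _ (id : R -> R) (2 * pi * z) x 1 1 (is_derive_id x 1).
  have H2 := @is_deriveD _ _ _ (fun x : R => 2 * pi * z *: x) (cst phi) x 1 (2 * pi * z *: 1) 0
      H1 (is_derive_cst phi x 1).
  by move: H2; rewrite addr0 /GRing.scale /= mulr1.
have cF : continuous F.
  move=> x; apply/differentiable_continuous/derivable1_diffP.
  by have := dF x => -[].
rewrite /unit_cos /Rintegral (@continuous_FTC2 _ _ F) //.
- by rewrite /F mulr1 mulr0 add0r -EFinB /= -mulrBr mulrC.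
- exact/continuous_subspaceT/continuous_cos_affine.
- split => [x _||]; first by have := dF x => -[].
    exact/cvg_at_right_filter/cF.
  exact/cvg_at_left_filter/cF.
- by move=> x _; rewrite derive1E; exact: derive_val.
Qed.

Lemma norm_unit_cos_le1 z phi : `|unit_cos z phi| <= 1.
Proof.
have i1 : leb.-integrable `[0%R, 1%R] (EFin \o (fun x : R => cos (2 * pi * z * x + phi))).
  exact/integrable_unit_continuous/continuous_cos_affine.
apply: le_trans (le_normr_Rintegral _ i1) _ => //.
apply: (@le_trans _ _ (\int[leb]_(x in `[0, 1]) (cst 1 x))).
  apply: le_Rintegral => //.
  - by have := integrable_norm i1.
  - exact/integrable_unit_continuous/cst_continuous.
  - by move=> x _; exact: cos_max.
by rewrite Rintegral_cst //= lebesgue_measure_itv /= lte_fin ltr01 -EFinD /= subr0 mulr1.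
Qed.

(** Boundedness near the origin, the explicit primitive elsewhere. For non-integer [z] the endpoints
    of the interval allow no better order of decay. *)
Lemma norm_unit_cos_le z phi : `|unit_cos z phi| <= 2 / jb z.
Proof.
have j0 := jb_gt0 z; rewrite ler_pdivlMr //.
have [z1|z1] := ltP `|z| 1.
  apply: le_trans (_ : 1 * jb z <= _); last by rewrite /jb; lra.
  by rewrite ler_wpM2r ?(ltW j0) // norm_unit_cos_le1.
have z0 : z != 0 by rewrite -normr_gt0 (lt_le_trans ltr01).
rewrite unit_cosE // normrM normfV !normrM.
have pz : 0 < `|2 : R| * `|pi| * `|z|.
  by rewrite !mulr_gt0 ?normr_gt0 // gt_eqF // pi_gt0.
rewrite mulrAC ler_pdivrMr //.
have h1 : `|sin (2 * pi * z + phi) - sin phi| <= 2.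
  apply: le_trans (ler_normB _ _) _; have := sin_max (2 * pi * z + phi); have := sin_max phi; lra.
apply: le_trans (ler_wpM2r (ltW j0) h1) _.
rewrite (ger0_norm (ler0n R 2)) (ger0_norm (pi_ge0 R)) /jb.
have : 2 * `|z| <= pi * `|z| by rewrite ler_wpM2r // pi_ge2.
rewrite -[2 * pi * `|z|]mulrA; move: (pi * `|z|) => y; lra.
Qed.

Lemma sin_2pi_int (m : int) : sin (2 * pi * m%:~R) = 0 :> R.
Proof.
have H (k : nat) : sin (2 * pi * k%:R) = 0 :> R.
  rewrite (_ : 2 * pi * k%:R = 0 + (pi *+ 2) *+ k) ?(periodicn (@sinD2pi R)) ?sin0 //.
  by rewrite add0r -[pi *+ 2]mulr_natl -[RHS]mulr_natr.
case: m => k; first exact: H.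
by rewrite NegzE mulrNz mulrN sinN H oppr0.
Qed.

Lemma unit_cos_int (m : int) : unit_cos m%:~R 0 = (m == 0)%:R.
Proof.
have [->|m0] := eqVneq m 0.
  rewrite /unit_cos (_ : \int[leb]_(x in `[0, 1]) _ = \int[leb]_(x in `[0, 1]) (cst 1 x)).
    by rewrite Rintegral_cst //= lebesgue_measure_itv /= lte_fin ltr01 -EFinD /= subr0 mulr1.
  by apply: eq_Rintegral => x _; rewrite mulr0 mul0r add0r cos0.
by rewrite unit_cosE ?intr_eq0 // addr0 sin_2pi_int sin0 subr0 mul0r.
Qed.

End UnitIntegral.

(** * Passage to the weak limit *)

Section RieszTransform.
Context {R : realType}.
Notation leb := (@lebesgue_measure R).
Variables (a : R^nat) (lam : nat -> nat).
Hypothesis lam_pos : forall j, (0 < lam j)%N.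
Hypothesis lam_lacunary : forall j, (3 * lam j <= lam j.+1)%N.
Variable mu : {finite_measure set (measurableTypeR R) -> \bar R}.
Hypothesis mu_riesz : is_riesz_product a lam mu.

Lemma integral_cos_riesz_density N z phi :
  \int[leb]_(x in `[0, 1]) (cos (2 * pi * z * x + phi) * riesz_density a lam N x) =
  \sum_(t <- riesz_terms a lam N) t.2 * (2^-1 * (unit_cos (z + t.1%:~R) phi + unit_cos (z -
      t.1%:~R) phi)).
Proof.
have ic y p := integrable_unit_continuous (@continuous_cos_affine R y p).
under eq_Rintegral do rewrite riesz_densityE mulr_sumr.
have ct (t : int * R) : continuous (fun x : R =>
    cos (2 * pi * z * x + phi) * (t.2 * cos (2 * pi * t.1%:~R * x))).
  move=> x; apply: cvgM; first exact: continuous_cos_affine.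
  apply: cvgM; first exact: cvg_cst.
  have := @continuous_cos_affine R (2 * pi * t.1%:~R) 0 x.
  by rewrite /continuous_at addr0; under eq_fun do rewrite addr0.
have cs (s : seq (int * R)) : continuous (fun x : R =>
    \sum_(t <- s) cos (2 * pi * z * x + phi) * (t.2 * cos (2 * pi * t.1%:~R * x))).
  elim: s => [|t s IH] x.
    rewrite (_ : (fun _ => _) = cst 0); first exact: cst_continuous.
    by apply/funext => y; rewrite big_nil.
  rewrite (_ : (fun _ => _) = fun x : R =>
      cos (2 * pi * z * x + phi) * (t.2 * cos (2 * pi * t.1%:~R * x)) +
      \sum_(t <- s) cos (2 * pi * z * x + phi) * (t.2 * cos (2 * pi * t.1%:~R * x))).
    by apply: cvgD; [exact: ct|exact: IH].
  by apply/funext => y; rewrite big_cons.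
elim: (riesz_terms a lam N) => [|t s IH].
  rewrite big_nil; under eq_Rintegral do rewrite big_nil.
  by rewrite Rintegral_cst // mul0r.
rewrite big_cons -IH; under eq_Rintegral do rewrite big_cons.
rewrite RintegralD //; try exact: integrable_unit_continuous.
have ip := ic (2 * pi * (z + t.1%:~R)) phi; have im := ic (2 * pi * (z - t.1%:~R)) phi.
congr (_ + _); rewrite /unit_cos -RintegralD // -!RintegralZl //; first last.
- exact: (integrableD _ ip im).
- by have := integrableZl _ 2^-1 (integrableD _ ip im); apply.
apply: eq_Rintegral => x _; rewrite mulrCA; congr (_ * _).
have -> : 2 * pi * (z + t.1%:~R) * x + phi = (2 * pi * z * x + phi) + 2 * pi * t.1%:~R * x by
    ring.
have -> : 2 * pi * (z - t.1%:~R) * x + phi = (2 * pi * z * x + phi) - 2 * pi * t.1%:~R * x by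
    ring.
set u := _ + phi; set v := 2 * pi * t.1%:~R * x.
by rewrite (cosB u v) (cosD u v); field.
Qed.

Lemma cvg_fcos_riesz z phi :
  (\sum_(t <- riesz_terms a lam N) t.2 *
     (2^-1 * (unit_cos (z + t.1%:~R) phi + unit_cos (z - t.1%:~R) phi)))
    @[N --> \oo] --> fcos mu z phi.
Proof.
have [mu01 H] := mu_riesz.
under eq_fun do rewrite -integral_cos_riesz_density.
rewrite /fcos Rintegral_supp01 //; last exact: integrable_cos_affine.
exact/H/continuous_subspaceT/continuous_cos_affine.
Qed.

(** A coefficient no longer changes once its frequency has appeared, so the limit is that of an
    eventually constant sequence: at integers [unit_cos] is a Kronecker delta, frequencies are
    distinct, and the halves from n and -n agree by symmetry. *)
Lemma fcos_riesz_term t N : t \in riesz_terms a lam N -> fcos mu t.1%:~R 0 = t.2.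
Proof.
move=> tN; have cv := @cvg_fcos_riesz t.1%:~R 0.
rewrite -(cvg_lim _ cv) //; apply: lim_near_cst => //; near=> M.
have tM : t \in riesz_terms a lam M.
  by apply: mem_riesz_terms_mono tN; near: M; exact: nbhs_infty_ge.
have delta (n : int) : \sum_(u <- riesz_terms a lam M) u.2 * (n == u.1)%:R =
    \sum_(u <- riesz_terms a lam M | u.1 == n) u.2.
  rewrite [RHS]big_mkcond; apply: eq_bigr => u _ /=; rewrite eq_sym.
  by case: eqP => _; rewrite ?mulr1 ?mulr0.
transitivity (\sum_(u <- riesz_terms a lam M) u.2 * (t.1 == u.1)%:R).
  have sym := sum_riesz_terms_opp a lam (fun n c => c * (t.1 == n)%:R) M.
  under eq_bigr do rewrite -!(intrD, intrB) !unit_cos_int addr_eq0 subr_eq0 mulrCA mulrDr.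
  rewrite -mulr_sumr big_split /= sym; set S := \sum_(_ <- _) _; field => //.
rewrite delta (perm_big _ (perm_to_rem tM)) big_cons eqxx big1_seq; first by rewrite /= addr0.
move=> u /andP[/eqP ut us]; have := uniq_riesz_terms a lam_pos lam_lacunary M.
rewrite (perm_uniq (perm_map fst (perm_to_rem tM))) /= => /andP[/negP[]].
by rewrite -ut; apply/mapP; exists u.
Unshelve. all: by end_near. Qed.

Lemma norm_fcos_riesz_le z phi (B : R) :
  (forall N, \sum_(t <- riesz_terms a lam N) `|t.2| / jb (z - t.1%:~R) <= B) ->
  `|fcos mu z phi| <= 2 * B.
Proof.
move=> HB; have cv := cvg_norm (@cvg_fcos_riesz z phi);
    move: cv => /(_ (@filter_filter _ _ _)) cv.
rewrite -(cvg_lim _ cv) //; apply: limr_le; first by apply/cvg_ex; eexists; exact: cv.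
near=> N; apply: le_trans (ler_norm_sum _ _ _) _.
have sym := sum_riesz_terms_opp a lam (fun n c => `|c| / jb (z - n%:~R)) N.
apply: (@le_trans _ _ (\sum_(t <- riesz_terms a lam N)
   (`|t.2| / jb (z - (- t.1)%:~R) + `|t.2| / jb (z - t.1%:~R)))); last first.
  by rewrite big_split /= sym; have := HB N; lra.
apply: ler_sum => t _; rewrite normrM -mulrDr ler_wpM2l // normrM (ger0_norm (_ : 0 <= 2^-1)) //.
rewrite ler_pdivrMl // intrN opprK; apply: le_trans (ler_normD _ _) _.
have := norm_unit_cos_le (z + t.1%:~R) phi; have := norm_unit_cos_le (z - t.1%:~R) phi; lra.
Unshelve. all: by end_near. Qed.

Lemma fnorm_riesz_le z (B : R) :
  (forall N, \sum_(t <- riesz_terms a lam N) `|t.2| / jb (z - t.1%:~R) <= B) ->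
  fnorm mu z <= 4 * B.
Proof.
move=> HB; apply: le_trans (fnorm_le _ _) _.
have := norm_fcos_riesz_le 0 HB; have := norm_fcos_riesz_le (pi / 2) HB; lra.
Qed.

End RieszTransform.

(** * Comparing the energy with the coefficients *)

Section EnergyBounds.
Context {R : realType}.
Notation leb := (@lebesgue_measure R).
Variables (a : R^nat) (lam : nat -> nat).
Hypothesis lam_pos : forall j, (0 < lam j)%N.
Hypothesis lam_lacunary : forall j, (3 * lam j <= lam j.+1)%N.
Variable mu : {finite_measure set (measurableTypeR R) -> \bar R}.
Hypothesis mu_riesz : is_riesz_product a lam mu.
Implicit Types (p s z : R).

Let mu01 : mu (~` `[0, 1]) = 0%E.
Proof. by case: mu_riesz. Qed.

Lemma measurable_fnorm_mul p (g : R -> R) : measurable_fun [set: R] g ->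
  measurable_fun [set: R] (EFin \o (fun z => fnorm mu z `^ p * g z)).
Proof.
move=> mg; apply/measurable_EFinP; apply: measurable_funM => //.
exact: measurable_fun_powR (@measurable_fnorm _ mu).
Qed.

Lemma measurable_norm_powR e : measurable_fun [set: R] (fun z : R => `|z| `^ e).
Proof. exact: (measurableT_comp (measurable_powR e) (@normr_measurable R setT)). Qed.

Let measurable_jb e : measurable_fun [set: R] (fun z : R => jb z `^ e).
Proof. exact: continuous_measurable_fun (@continuous_jb_powR R e). Qed.

(** On [-1, 1] the transform is bounded by twice the mass and <z>^t by 2^|t|; outside, |z| <= <z> <=
    2 |z|, which serves both signs of [t]. *)
Lemma integral_fnorm_jb_lty p (t : R) : 0 <= p ->
  (\int[leb]_z (fnorm mu z `^ p * `|z| `^ t)%:E < +oo)%E ->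
  (\int[leb]_z (fnorm mu z `^ p * jb z `^ t)%:E < +oo)%E.
Proof.
move=> p0 fin; set c := (2 * mass mu) `^ p; set d := 2 `^ `|t|.
have m1 : measurable_fun [set: R] (EFin \o (fun z => c * \1_`[(-1), 1]%classic z)).
  apply/measurable_EFinP; apply: measurable_funM; first exact: measurable_cst.
  by apply: measurable_indic; exact: measurable_itv.
have m2 := measurable_fnorm_mul p (measurable_norm_powR t).
apply: (@le_lt_trans _ _ (\int[leb]_z (d%:E * ((fnorm mu z `^ p * `|z| `^ t)%:E +
    (c * \1_`[(-1), 1]%classic z)%:E)))%E).
  apply: ge0_le_integral => //.
  - by move=> z _; rewrite lee_fin mulr_ge0 ?powR_ge0.
  - exact: measurable_fnorm_mul.
  - by apply: measurable_funeM; exact: emeasurable_funD.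
  - move=> z _; rewrite -EFinD -EFinM lee_fin.
    have [z1|z1] := leP `|z| 1.
      rewrite indicE mem_set /=; last by rewrite /= in_itv /= -ler_norml.
      rewrite mulr1 mulrDr; apply: le_trans (_ : d * c <= _); last first.
        by rewrite lerDr !mulr_ge0 ?powR_ge0.
      rewrite mulrC ler_pM ?powR_ge0 //.
        apply: le_trans (_ : jb z `^ `|t| <= _).
          by apply: ler_powR; [exact: jb_ge1|exact: ler_norm].
        by apply: ge0_ler_powR; rewrite ?nnegrE ?(ltW (jb_gt0 _)) // /jb; lra.
      by apply: ge0_ler_powR; rewrite ?nnegrE ?fnorm_ge0 ?mulr_ge0 ?mass_ge0 // fnorm_le_mass.
    rewrite indicE memNset /=; last by rewrite in_itv /= -ler_norml; apply/negP; rewrite -ltNge.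
    rewrite mulr0 addr0 mulrCA ler_wpM2l ?powR_ge0 //.
    have z0 : 0 < `|z| by apply: lt_trans z1.
    have [t0|t0] := leP 0 t.
      rewrite /d ger0_norm // -powRM //; apply: ge0_ler_powR;
          rewrite ?nnegrE ?mulr_ge0 ?(ltW (jb_gt0 _)) // /jb; lra.
    apply: le_trans (_ : 1 * `|z| `^ t <= _); last first.
      by rewrite ler_wpM2r ?powR_ge0 // -(powRr0 2) ler_powR // ler1n.
    rewrite mul1r -[t]opprK; apply: ler_powRN => //; last by lra.
    by rewrite /jb lerDr.
rewrite ge0_integralZl_EFin ?powR_ge0 //; first last.
- exact: emeasurable_funD.
- by move=> z _; rewrite -EFinD lee_fin addr_ge0 ?mulr_ge0 ?powR_ge0.
rewrite ge0_integralD //; first last.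
- by move=> z _; rewrite lee_fin mulr_ge0 ?powR_ge0.
- by move=> z _; rewrite lee_fin mulr_ge0 ?powR_ge0.
apply: lte_mul_pinfty; rewrite ?lee_fin ?powR_ge0 //; apply: lte_add_pinfty => //.
under eq_integral do rewrite EFinM.
rewrite ge0_integralZl_EFin ?powR_ge0 //; last first.
  by apply/measurable_EFinP; apply: measurable_indic; exact: measurable_itv.
rewrite integral_indic //.
by rewrite setIT /= lebesgue_measure_itv /=; case: ifP => _; rewrite -?EFinB -?EFinM ?mule0 ltry.
Qed.

(** Peetre's inequality turns the kernel weight <z - n>^-2 into <n>^-t <z>^t; the decay 2 of the
    kernel is the reason for t <= 2. *)
Lemma fcos_decay p (t : R) : 1 < p -> 0 <= t <= 2 ->
  (\int[leb]_z (fnorm mu z `^ p * jb z `^ t)%:E < +oo)%E ->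
  exists K : R, forall n, `|fcos mu n 0| `^ p <= K * jb n `^ (- t).
Proof.
move=> p1 /andP[t0 t2] fin; have [K K0 HK] := fcos_powR_le mu01 p1.
set V := (\int[leb]_z _)%E in fin.
have Vfin : V \is a fin_num.
  rewrite ge0_fin_numE //; apply: integral_ge0 => z _.
  by rewrite lee_fin mulr_ge0 ?powR_ge0.
exists (K * (2 * fine V)) => n; rewrite -lee_fin.
apply: le_trans (HK n) _; rewrite -!mulrA EFinM lee_pmul2l ?lte_fin //.
rewrite [_ * (_ * _)](_ : _ = 2 * jb n `^ (- t) * fine V); last by ring.
rewrite EFinM fineK // -ge0_integralZl_EFin //; first last.
- by rewrite mulr_ge0 ?powR_ge0.
- exact: measurable_fnorm_mul.
- by move=> z _; rewrite lee_fin mulr_ge0 ?powR_ge0.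
have mj (m : R) : measurable_fun [set: R] (fun z : R => jb (z - m) `^ (- 2)).
  exact: continuous_measurable_fun (continuous_translate (@continuous_jb_powR R (- 2))).
apply: ge0_le_integral => //.
- by move=> z _; rewrite lee_fin mulr_ge0 ?addr_ge0 ?powR_ge0.
- apply: measurable_fnorm_mul; apply: measurable_funD => //.
  by have := mj (- n); under eq_fun do rewrite opprK.
- by apply: measurable_funeM; exact: measurable_fnorm_mul.
- move=> z _; rewrite -EFinM lee_fin mulrCA ler_wpM2l ?powR_ge0 //.
  have key m : jb m = jb n -> jb (z - m) `^ (- 2) <= jb n `^ (- t) * jb z `^ t.
    move=> mn; apply: le_trans (_ : jb (z - m) `^ (- t) <= _).
      by apply: ler_powR; rewrite ?jb_ge1 // lerN2.
    by rewrite jbB mulrC -mn; exact: jb_peetre.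
  have k1 := key n erefl; have k2 := key (- n) (jbN n); rewrite opprK in k2; lra.
Qed.

(** In the sampling inequality <z - n>^-2 splits as <z - n>^-(1 + (1 - s)), summable over the
    frequencies uniformly in z as s < 1, times <z - n>^-s, which is at most <n>^s <z>^-s with <n> <=
    lam N. *)
Lemma sum_riesz_terms_le p s : 1 < p -> 0 <= s < 1 ->
  (\int[leb]_z (fnorm mu z `^ p * jb z `^ (- s))%:E < +oo)%E ->
  exists K : R, forall N,
    \sum_(t <- riesz_terms a lam N) `|t.2| `^ p <= K * (lam N)%:R `^ s.
Proof.
move=> p1 /andP[s0 s1] fin; have [K K0 HK] := fcos_powR_le mu01 p1.
set V := (\int[leb]_z _)%E in fin.
have Vfin : V \is a fin_num.
  rewrite ge0_fin_numE //; apply: integral_ge0 => z _.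
  by rewrite lee_fin mulr_ge0 ?powR_ge0.
have [W W0 HW] : exists2 W : R, 0 <= W & forall N z,
    \sum_(t <- riesz_terms a lam N) jb (z - t.1%:~R) `^ (- (1 + (1 - s))) <= W.
  exists (2 `^ (1 + (1 - s)) * (2 * (1 + (1 - s)^-1))).
    by rewrite mulr_ge0 ?powR_ge0 // mulr_ge0 // addr_ge0 // invr_ge0; lra.
  by move=> N z; apply: sum_riesz_terms_jb_le => //; rewrite subr_gt0.
exists (K * (2 * W * fine V)) => N; rewrite -lee_fin -sumEFin.
pose g (t : int * R) z := fnorm mu z `^ p * (jb (z - t.1%:~R) `^ (- 2) + jb (z + t.1%:~R) `^ (-
    2)).
have mj (m : R) : measurable_fun [set: R] (fun z : R => jb (z - m) `^ (- 2)).
  exact: continuous_measurable_fun (continuous_translate (@continuous_jb_powR R (- 2))).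
have mg (t : int * R) : measurable_fun [set: R] (EFin \o g t).
  apply: measurable_fnorm_mul; apply: measurable_funD => //.
  by have := mj (- t.1%:~R); under eq_fun do rewrite opprK.
have g0 (t : int * R) z : (0 <= (g t z)%:E)%E by rewrite lee_fin mulr_ge0 ?addr_ge0 ?powR_ge0.
apply: (@le_trans _ _ (K%:E * \int[leb]_z \sum_(t <- riesz_terms a lam N) (g t z)%:E)%E).
  rewrite ge0_integral_sum // ge0_sume_distrr; last by move=> t _; exact: integral_ge0.
  rewrite big_seq [X in (_ <= X)%E]big_seq; apply: lee_sum => t tN.
  by rewrite -(fcos_riesz_term lam_pos lam_lacunary mu_riesz tN); exact: HK.
rewrite -!mulrA EFinM lee_pmul2l ?lte_fin //.
rewrite [2 * _](_ : _ = 2 * W * (lam N)%:R `^ s * fine V); last by ring.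
rewrite EFinM fineK // -ge0_integralZl_EFin //; first last.
- by rewrite !mulr_ge0 ?powR_ge0.
- exact: measurable_fnorm_mul.
- by move=> z _; rewrite lee_fin mulr_ge0 ?powR_ge0.
apply: ge0_le_integral => //.
- by move=> z _; apply: sume_ge0.
- exact: emeasurable_sum.
- by apply: measurable_funeM; exact: measurable_fnorm_mul.
- move=> z _; rewrite sumEFin -EFinM lee_fin -mulr_sumr mulrCA ler_wpM2l ?powR_ge0 //.
  have sym := sum_riesz_terms_opp a lam (fun n c => jb (z - n%:~R) `^ (- 2)) N.
  rewrite big_split /= [X in _ + X](_ : _ =
      \sum_(t <- riesz_terms a lam N) jb (z - (- t.1)%:~R) `^ (- 2)); last first.
    by apply: eq_bigr => t _; rewrite intrN opprK.
  have dbl (x : R) : x + x = 2 * x by ring.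
  rewrite sym dbl -!mulrA ler_pM2l //.
  apply: (@le_trans _ _ (\sum_(t <- riesz_terms a lam N) jb (z - t.1%:~R) `^ (- (1 + (1 - s))) *
      ((lam N)%:R `^ s * jb z `^ (- s)))).
    rewrite big_seq [X in _ <= X]big_seq; apply: ler_sum => t tN.
    have -> : - 2 = - (1 + (1 - s)) + - s by ring.
    rewrite powRD ?(gt_eqF (jb_gt0 _)) ?implybT // ler_wpM2l ?powR_ge0 //.
    apply: le_trans (jb_peetre _ _ s0) _; rewrite ler_wpM2r ?powR_ge0 //.
    apply: ge0_ler_powR => //; rewrite ?nnegrE ?(ltW (jb_gt0 _)) //.
    have := mem_riesz_terms_norm_le lam_pos lam_lacunary tN; case: t tN => n c _ /= h.
    by rewrite /jb -intr_norm -natr_absz nat1r ler_nat; lia.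
  by rewrite -mulr_suml ler_wpM2r ?mulr_ge0 ?powR_ge0.
Qed.

(** Frequencies new at level k exceed half of [lam k] in modulus, so their contribution is
    O(lam_k^(q - s)), which decays geometrically because lam_k >= 3^k. *)
Lemma sum_riesz_terms_jbN_le p q s (C : R) : 0 <= s -> q < s ->
  (forall k, \sum_(t <- riesz_terms a lam k.+1) `|t.2| `^ p <= C * (lam k)%:R `^ q) ->
  exists Q : R, forall N,
    \sum_(t <- riesz_terms a lam N) `|t.2| `^ p * jb (t.1%:~R : R) `^ (- s) <= Q.
Proof.
move=> s0 qs HC; pose r : R := 3 `^ (- (s - q)).
have r01 : 0 <= r < 1.
  rewrite powR_ge0 /= /r /powR pnatr_eq0 /= expR_lt1 mulNr oppr_lt0 mulr_gt0 ?subr_gt0 //.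
  by rewrite ln_gt0 // ltr1n.
have C0 : 0 <= C.
  have := HC 0; rewrite -(pmulr_lge0 C (_ : 0 < (lam 0)%:R `^ q)) ?powR_gt0 ?ltr0n // mulrC.
  by apply: le_trans; apply: sumr_ge0 => t _; exact: powR_ge0.
have step k : \sum_(t <- riesz_terms a lam k.+1) `|t.2| `^ p * jb (t.1%:~R : R) `^ (- s) <=
    \sum_(t <- riesz_terms a lam k) `|t.2| `^ p * jb (t.1%:~R : R) `^ (- s) +
    2 `^ s * C * r ^+ k.
  have l0 : 0 < (lam k)%:R :> R by rewrite ltr0n.
  rewrite (sum_riesz_termsS _ _ (fun n c => `|c| `^ p * jb (n%:~R : R) `^ (- s))).
  rewrite big_split /= lerD2l.
  have low (n : int) : (`|n|.*2 < lam k)%N ->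
      jb ((n + (lam k)%:Z)%:~R : R) `^ (- s) <= 2 `^ s * (lam k)%:R `^ (- s) /\
      jb ((n - (lam k)%:Z)%:~R : R) `^ (- s) <= 2 `^ s * (lam k)%:R `^ (- s).
    move=> nl; have -> : 2 `^ s * (lam k)%:R `^ (- s) = ((lam k)%:R / 2) `^ (- s) :> R.
      rewrite powRM ?invr_ge0 // -(powR_inv1 (ler0n R 2)) -powRrM mulrNN mul1r mulrC //.
    have l2 : 0 < (lam k)%:R / 2 :> R by rewrite divr_gt0.
    split; apply: ler_powRN => //; rewrite /jb -intr_norm -natr_absz nat1r ler_pdivrMr // -natrM
        ler_nat; lia.
  (* The old terms are added back so that the total is the mass at level k + 1, the one [HC]
     controls. *)
  apply: (@le_trans _ _ (\sum_(t <- riesz_terms a lam k)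
      (`|t.2| `^ p + (`|t.2 * (a k / 2)| `^ p + `|t.2 * (a k / 2)| `^ p)) *
      (2 `^ s * (lam k)%:R `^ (- s)))).
    rewrite big_seq [X in _ <= X]big_seq; apply: ler_sum => t tk.
    have [h1 h2] := low _ (mem_riesz_terms_norm_le lam_pos lam_lacunary tk).
    have X0 : 0 <= `|t.2 * (a k / 2)| `^ p by exact: powR_ge0.
    have Y0 : 0 <= `|t.2| `^ p by exact: powR_ge0.
    have Z0 : 0 <= 2 `^ s * (lam k)%:R `^ (- s) :> R by rewrite mulr_ge0 ?powR_ge0.
    have := ler_wpM2l X0 h1; have := ler_wpM2l X0 h2; have := mulr_ge0 Y0 Z0; lra.
  rewrite -mulr_suml -(sum_riesz_termsS _ _ (fun n c => `|c| `^ p)).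
  have Z0 : 0 <= 2 `^ s * (lam k)%:R `^ (- s) :> R by rewrite mulr_ge0 ?powR_ge0.
  apply: le_trans (ler_wpM2r Z0 (HC k)) _.
  have -> : C * (lam k)%:R `^ q * (2 `^ s * (lam k)%:R `^ (- s)) =
      2 `^ s * C * (lam k)%:R `^ (- (s - q)).
    by rewrite opprB powRD ?(gt_eqF l0) ?implybT //; ring.
  rewrite ler_wpM2l ?mulr_ge0 ?powR_ge0 // /r -powR_mulrn ?powR_ge0 // powRAC.
  apply: ler_powRN; first by rewrite powR_gt0.
    rewrite powR_mulrn // -natrX ler_nat; exact: expn3_le_lam.
  by rewrite subr_ge0 ltW.
exists (1 + 2 `^ s * C * (1 - r)^-1) => N.
apply: le_trans (_ : 1 + 2 `^ s * C * \sum_(0 <= k < N) r ^+ k <= _); last first.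
  by rewrite lerD2l ler_wpM2l ?geometric_sum_le // mulr_ge0 ?powR_ge0.
elim: N => [|k IH].
  by rewrite big_seq1 big_geq // mulr0 addr0 normr1 powR1 mul1r jbV_powR_le1.
by apply: le_trans (step k) _; rewrite big_nat_recr //= mulrDr addrA lerD2r.
Qed.

Let G p b N z : R := \sum_(t <- riesz_terms a lam N) `|t.2| `^ p * jb (z - t.1%:~R) `^ (- b).

Let G_ge0 p b N z : 0 <= G p b N z.
Proof. by apply: sumr_ge0 => t _; rewrite mulr_ge0 ?powR_ge0. Qed.

Let G_mono p b z : {homo (fun N => G p b N z) : m n / (m <= n)%N >-> m <= n}.
Proof.
apply: homo_leq => [//|x y w /le_trans|k]; first exact.
rewrite /G /= big_cat /= lerDl; apply: sumr_ge0 => t _.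
by rewrite mulr_ge0 ?powR_ge0.
Qed.

Let continuous_term b (n : R) : continuous (fun z : R => jb (z - n) `^ (- b)).
Proof. exact: continuous_translate (@continuous_jb_powR R (- b)). Qed.

Let measurable_G p b N : measurable_fun [set: R] (G p b N).
Proof.
apply: measurable_sum => t; apply: measurable_funM; first exact: measurable_cst.
exact: continuous_measurable_fun (@continuous_term b _).
Qed.

(* Jensen with the weights <z - n>^-(1+d), summable over the spectrum, trades the slow decay
   <z - n>^-1 of the transform of an interval for an exponent arbitrarily close to 1. *)
Lemma fnorm_powR_le p (d : R) : 1 < p -> 0 < d -> exists2 K : R, 0 < K & forall z (g : R),
  (forall N, \sum_(t <- riesz_terms a lam N) `|t.2| `^ p * jb (z - t.1%:~R) `^ (- (1 - (p - 1) *
      d)) <= g) ->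
  fnorm mu z `^ p <= K * g.
Proof.
move=> p1 d0; have p0 : 0 < p by lra.
have [W W0 HW] : exists2 W : R, 0 < W & forall N z,
    \sum_(t <- riesz_terms a lam N) jb (z - t.1%:~R) `^ (- (1 + d)) <= W.
  exists (2 `^ (1 + d) * (2 * (1 + d^-1))).
    by rewrite mulr_gt0 ?powR_gt0 // mulr_gt0 // addr_gt0 // invr_gt0.
  by move=> N z; exact: sum_riesz_terms_jb_le.
exists (4 `^ p * W `^ (p - 1)); first by rewrite mulr_gt0 ?powR_gt0.
move=> z g Hg; have g0 : 0 <= g.
  by apply: le_trans (Hg 0); apply: sumr_ge0 => t _; rewrite mulr_ge0 ?powR_ge0.
(* The p-th root of the Jensen bound, so that the aim is the partial-sum bound [B] required by
   [fnorm_riesz_le], the source of the factor 4. *)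
set B := (W `^ (p - 1) * g) `^ p^-1.
have Bp : B `^ p = W `^ (p - 1) * g.
  by rewrite /B -powRrM mulVf ?gt_eqF // powRr1 // mulr_ge0 ?powR_ge0.
rewrite -mulrA -Bp -powRM ?powR_ge0 //.
apply: ge0_ler_powR; rewrite ?nnegrE ?fnorm_ge0 ?mulr_ge0 ?powR_ge0 ?(ltW p0) //.
apply: (fnorm_riesz_le mu_riesz) => N.
set X := \sum_(t <- _) _.
have X0 : 0 <= X by apply: sumr_ge0 => t _; rewrite divr_ge0 // ltW // jb_gt0.
have jD (y e1 e2 : R) : jb y `^ (e1 + e2) = jb y `^ e1 * jb y `^ e2.
  by rewrite powRD // (gt_eqF (jb_gt0 _)) implybT.
(* The weight times |c| <z - n>^d is |c| <z - n>^-1, and the weight times its p-th power has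
   exponent -(1 + d) + d p = -(1 - (p - 1) d). *)
have := @jensen_sum R _ (riesz_terms a lam N) (fun t => jb (z - t.1%:~R) `^ (- (1 + d)))
  (fun t => `|t.2| * jb (z - t.1%:~R) `^ d) p X W p1 W0 X0.
move=> /(_ (fun _ => powR_ge0 _ _) (fun _ => mulr_ge0 (normr_ge0 _) (powR_ge0 _ _)) (HW N z)).
have XE : X <= \sum_(t <- riesz_terms a lam N)
    jb (z - t.1%:~R) `^ (- (1 + d)) * (`|t.2| * jb (z - t.1%:~R) `^ d).
  apply: ler_sum => t _; rewrite mulrCA -jD (_ : - (1 + d) + d = - 1); last by ring.
  by rewrite powR_inv1 // ltW // jb_gt0.
move=> /(_ XE) H.
have XB : X `^ p <= B `^ p.
  rewrite Bp; apply: le_trans H _; rewrite ler_wpM2l ?powR_ge0 //.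
  apply: le_trans (Hg N); apply: ler_sum => t _.
  rewrite powRM ?powR_ge0 // mulrCA -powRrM -jD ler_wpM2l ?powR_ge0 //.
  by rewrite (_ : - (1 + d) + d * p = - (1 - (p - 1) * d)) //; ring.
have up (y : R) : 0 <= y -> (y `^ p) `^ p^-1 = y.
  by move=> y0; rewrite -powRrM mulfV ?gt_eqF // powRr1.
suff : (X `^ p) `^ p^-1 <= (B `^ p) `^ p^-1 by rewrite !up ?powR_ge0.
by apply: ge0_ler_powR; rewrite ?nnegrE ?powR_ge0 // invr_ge0 ltW.
Qed.

Lemma integral_fnorm_jbN_lty p q s (C : R) : 1 < p -> 0 <= q < s -> s < 1 ->
  (forall k, \sum_(t <- riesz_terms a lam k.+1) `|t.2| `^ p <= C * (lam k)%:R `^ q) ->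
  (\int[leb]_z (fnorm mu z `^ p * jb z `^ (- s))%:E < +oo)%E.
Proof.
move=> p1 /andP[q0 qs] s1 HC.
(* t > q makes the sum of |c_n|^p <n>^-t converge; the Jensen loss (p - 1) d = (s - t) / 2 leaves b
   + s - t = 1 + (s - t) / 2 > 1, the integrability required after [jb_three]. *)
pose t := (q + s) / 2; have qt : q < t by rewrite /t; lra.
have ts : t < s by rewrite /t; lra.
have t0 : 0 <= t by lra.
pose d := (s - t) / (2 * (p - 1)).
have d0 : 0 < d by rewrite divr_gt0 //; lra.
have dE : (p - 1) * d = (s - t) / 2 by rewrite /d; field; rewrite subr_eq0 gt_eqF.
have [K K0 HK] := fnorm_powR_le p1 d0; rewrite dE in HK.
set b := 1 - (s - t) / 2 in HK.
have [Q HQ] := sum_riesz_terms_jbN_le t0 qt HC.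
have k1 : 1 < b + s - t by rewrite /b; lra.
pose g N z : \bar R := (K * G p b N z * jb z `^ (- s))%:E.
have mg N : measurable_fun [set: R] (g N).
  apply/measurable_EFinP; apply: measurable_funM => //.
  exact: (@measurable_funM _ _ _ _ (cst K)).
have g0 N z : (0 <= g N z)%E by rewrite lee_fin !mulr_ge0 ?powR_ge0 // ltW.
have gmono z : nondecreasing_seq (g ^~ z).
  move=> m n mn; rewrite lee_fin ler_wpM2r ?powR_ge0 // ler_pM2l //; exact: G_mono.
have glim z := ereal_nondecreasing_cvgn (gmono z).
have mono := @monotone_convergence _ _ _ leb setT measurableT g mg (fun N z _ => g0 N z) (fun z
    _ => gmono z).
apply: (@le_lt_trans _ _ (\int[leb]_z limn (g ^~ z))%E).
  apply: ge0_le_integral => //.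
  - by move=> z _; rewrite lee_fin mulr_ge0 ?powR_ge0.
  - exact: measurable_fnorm_mul.
  - apply: emeasurable_fun_cvg => [N|z _]; first exact: mg.
    by rewrite (cvg_lim _ (glim z)) //; exact: glim.
  - move=> z _; rewrite (cvg_lim _ (glim z)) //.
    have jz : 0 < jb z `^ (- s) by rewrite powR_gt0 // jb_gt0.
    have ub N : (g N z <= ereal_sup (range (g ^~ z)))%E.
      by apply: ereal_sup_ubound; exists N.
    (* Where the limit is infinite nothing is to be shown; where it is a real [l], it bounds all
       partial sums and [HK] applies. *)
    move: ub; case: (ereal_sup _) => [l|_|/(_ 0)]; first last.
    + by rewrite leNgt (lt_le_trans _ (g0 0 z)) // ltNye.
    + by rewrite leey.
    move=> ub; rewrite lee_fin -ler_pdivlMr //.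
    apply: le_trans (HK z (l / (K * jb z `^ (- s))) _) _.
      move=> N; rewrite ler_pdivlMr ?mulr_gt0 // mulrCA mulrA.
      by have := ub N; rewrite lee_fin.
    rewrite (_ : K * _ = l / jb z `^ (- s)) //; set j := jb z `^ (- s) in jz *.
    by field; rewrite (gt_eqF jz) (gt_eqF K0).
rewrite mono; apply: (@le_lt_trans _ _ (K * (2 `^ t * (2 * (2 / (b + s - t - 1)))) * Q)%:E);
    last exact: ltry.
apply: lime_le.
  apply: ereal_nondecreasing_is_cvgn => m n mn; apply: ge0_le_integral => //;
    [exact: mg|exact: mg|by move=> z _; exact: gmono].
near=> N; set c := 2 / (b + s - t - 1).
(* The bound of [jb_three], term by term: both brackets have integral 2 / (b + s - t - 1) wherever
   they are centred, and <n>^-t is left for the sum. *)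
pose h (u : int * R) z : R := (K * (`|u.2| `^ p * jb (u.1%:~R : R) `^ (- t)) * 2 `^ t) *
   (jb (z - 0) `^ (- (b + s - t)) + jb (z - u.1%:~R) `^ (- (b + s - t))).
have A0 (u : int * R) : 0 <= K * (`|u.2| `^ p * jb (u.1%:~R : R) `^ (- t)) * 2 `^ t.
  by rewrite !mulr_ge0 ?powR_ge0 // ltW.
have mh u : measurable_fun [set: R] (fun z => (h u z)%:E).
  apply/measurable_EFinP; apply: measurable_funM; first exact: measurable_cst.
  by apply: measurable_funD; exact: continuous_measurable_fun (@continuous_term _ _).
have h0 u z : (0 <= (h u z)%:E)%E by rewrite lee_fin mulr_ge0 // addr_ge0 ?powR_ge0.
have ih u : (\int[leb]_z (h u z)%:E = (K * (`|u.2| `^ p * jb (u.1%:~R : R) `^ (- t)) * 2 `^ t *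
    (2 * c))%:E)%E.
  rewrite /h; under eq_integral do rewrite mulrDr EFinD.
  have mm (n : R) : measurable_fun [set: R] (EFin \o (fun z : R => K * (`|u.2| `^ p * jb
      (u.1%:~R : R) `^ (- t)) * 2 `^ t * jb (z - n) `^ (- (b + s - t)))).
    apply/measurable_EFinP; apply: measurable_funM; first exact: measurable_cst.
    exact: continuous_measurable_fun (@continuous_term _ _).
  rewrite ge0_integralD //; [|by move=> z _; rewrite lee_fin mulr_ge0 ?powR_ge0|exact: mm|
    by move=> z _; rewrite lee_fin mulr_ge0 ?powR_ge0|exact: mm].
  by rewrite !integral_jb_powRN_translate // -EFinD -mulrDr -/c mulr_natl.
apply: (@le_trans _ _ (\int[leb]_z \sum_(u <- riesz_terms a lam N) (h u z)%:E)%E).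
  apply: ge0_le_integral => //.
  - exact: mg.
  - by apply: emeasurable_sum => u; exact: mh.
  - move=> z _; rewrite sumEFin lee_fin /G mulr_sumr mulr_suml; apply: ler_sum => u _.
    rewrite /h subr0 -!mulrA ler_pM2l // ler_wpM2l ?powR_ge0 //.
    have jn := jb_gt0 (u.1%:~R : R).
    rewrite [jb u.1%:~R `^ _]powRN -ler_pdivrMl ?invr_gt0 ?powR_gt0 // invrK.
    by apply: jb_three; rewrite // /b; lra.
rewrite ge0_integral_sum //; under eq_bigr do rewrite ih.
rewrite sumEFin lee_fin; apply: le_trans (_ : K * (2 `^ t * (2 * c)) *
  \sum_(u <- riesz_terms a lam N) `|u.2| `^ p * jb (u.1%:~R : R) `^ (- t) <= _).
  by rewrite mulr_sumr; apply: ler_sum => u _; rewrite le_eqVlt; apply/orP; left; apply/eqP; ring.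
rewrite ler_wpM2l // mulr_ge0 ?(ltW K0) // mulr_ge0 ?powR_ge0 // mulr_ge0 // divr_ge0 //; lra.
Unshelve. all: by end_near. Qed.

(** Return to the singular weight: on [-1, 1] the transform is bounded and |z|^-s integrable as s <
    1; outside, |z|^-s <= 2^s <z>^-s. *)
Lemma integral_fnorm_norm_lty p q s (C : R) : 1 < p -> 0 <= q < s -> s < 1 ->
  (forall k, \sum_(t <- riesz_terms a lam k.+1) `|t.2| `^ p <= C * (lam k)%:R `^ q) ->
  (\int[leb]_z (fnorm mu z `^ p * `|z| `^ (- s))%:E < +oo)%E.
Proof.
move=> p1 qs s1 HC; have fin := integral_fnorm_jbN_lty p1 qs s1 HC.
have s0 : 0 < s by case/andP: qs => *; lra.
have s01 : 0 < s < 1 by rewrite s0.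
have fin1 := integral_powRN_lty s01.
set c := (2 * mass mu) `^ p.
pose f z : \bar R := (`|z| `^ (- s))%:E.
have mn : measurable_fun [set: R] f.
  by apply: measurableT_comp => //; exact: measurable_norm_powR.
have mi : measurable_fun [set: R] (f \_ `[(-1)%R, 1%R]%classic).
  by apply/(measurable_restrictT _ _).1 => //; exact: measurable_funTS.
have mf : measurable_fun [set: R] (fun z => (fnorm mu z `^ p * jb z `^ (- s))%:E).
  exact: measurable_fnorm_mul.
have r0 z : (0 <= (f \_ `[(-1)%R, 1%R]%classic) z)%E.
  by rewrite patchE; case: ifP => //; rewrite lee_fin powR_ge0.
apply: (@le_lt_trans _ _ (\int[leb]_z
   (c%:E * (f \_ `[(-1)%R, 1%R]%classic) z +
    (2 `^ s)%:E * (fnorm mu z `^ p * jb z `^ (- s))%:E))%E).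
  apply: ge0_le_integral => //.
  - by move=> z _; rewrite lee_fin mulr_ge0 ?powR_ge0.
  - exact: measurable_fnorm_mul (measurable_norm_powR _).
  - by apply: emeasurable_funD; exact: measurable_funeM.
  - move=> z _; rewrite patchE; case: ifPn => [|] zI.
      apply: le_trans (_ : (c%:E * f z <= _)%E); last first.
        by rewrite leeDl // -EFinM lee_fin !mulr_ge0 ?powR_ge0.
      rewrite -EFinM lee_fin ler_wpM2r ?powR_ge0 // ge0_ler_powR ?nnegrE ?fnorm_ge0 ?mulr_ge0
          ?mass_ge0 ?fnorm_le_mass //; lra.
    have z1 : 1 < `|z|.
      by rewrite ltNge ler_norml; move: zI; rewrite notin_setE /= in_itv /= => /negP.
    rewrite mule0 add0e -EFinM lee_fin mulrCA ler_wpM2l ?powR_ge0 //.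
    have -> : 2 `^ s * jb z `^ (- s) = (jb z / 2) `^ (- s).
      rewrite powRM ?invr_ge0 ?(ltW (jb_gt0 _)) // -(powR_inv1 (ler0n R 2)) -powRrM mulrNN mul1r
          mulrC //.
    by apply: ler_powRN; rewrite ?divr_gt0 ?jb_gt0 ?(ltW s0) // /jb; lra.
rewrite ge0_integralD //; first last.
- exact: measurable_funeM.
- by move=> z _; rewrite -EFinM lee_fin !mulr_ge0 ?powR_ge0.
- exact: measurable_funeM.
- by move=> z _; rewrite mule_ge0 // lee_fin powR_ge0.
rewrite !ge0_integralZl_EFin ?powR_ge0 //; last first.
  by move=> z _; rewrite lee_fin mulr_ge0 ?powR_ge0.
rewrite -integral_mkcond; apply: lte_add_pinfty.
  by apply: lte_mul_pinfty => //; rewrite lee_fin powR_ge0.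
by apply: lte_mul_pinfty => //; rewrite lee_fin powR_ge0.
Qed.

End EnergyBounds.

(** * The Fourier spectrum *)

Section Spectrum.
Context {R : realType}.
Notation leb := (@lebesgue_measure R).

Lemma energy_ltyP (mu : {finite_measure set (measurableTypeR R) -> \bar R}) (s theta : R) :
  0 < theta -> (energy mu s theta < +oo)%E <->
  (\int[leb]_z (fnorm mu z `^ (2 / theta) * `|z| `^ (s / theta - 1))%:E < +oo)%E.
Proof.
move=> t0; split => [|/poweR_lty]; last exact.
by apply: lty_poweRy; rewrite gt_eqF.
Qed.

(** Absorbs the loss in s: each direction reaches only exponents below s, and positive ones suffice
    since the bound is nonnegative. *)
Lemma lee_approx (x : \bar R) (s : R) : (0 <= x)%E ->
  (forall s', 0 < s' < s -> (s'%:E <= x)%E) -> (s%:E <= x)%E.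
Proof.
case: x => [r| |] x0 H; last by move: x0; rewrite leNgt ltNyr.
  rewrite lee_fin leNgt; apply/negP => rs; rewrite lee_fin in x0.
  have : (((r + s) / 2)%:E <= r%:E)%E by apply: H; apply/andP; split; lra.
  rewrite lee_fin; lra.
by rewrite leey.
Qed.

Variables (a : R^nat) (lam : nat -> nat).
Hypothesis lam_pos : forall j, (0 < lam j)%N.
Hypothesis lam_lacunary : forall j, (3 * lam j <= lam j.+1)%N.

Let lamR_gt0 k : 0 < (lam k)%:R :> R. Proof. by rewrite ltr0n. Qed.

Lemma riesz_seriesE theta s : riesz_series a lam theta s =
  (\sum_(0 <= k <oo) ((lam k)%:R `^ (s / theta - 1) *
     \sum_(t <- riesz_terms a lam k.+1) `|t.2| `^ (2 / theta))%:E)%E.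
Proof.
by rewrite /riesz_series; congr (limn _); apply/funext => n; apply: eq_bigr => k _;
  rewrite sum_riesz_terms_powR.
Qed.

Let sum_terms_ge0 p N : 0 <= \sum_(t <- riesz_terms a lam N) `|t.2| `^ p.
Proof. by apply: sumr_ge0 => t _; exact: powR_ge0. Qed.

Lemma riesz_series_lty_le theta s : (riesz_series a lam theta s < +oo)%E ->
  exists C : R, forall k,
    \sum_(t <- riesz_terms a lam k.+1) `|t.2| `^ (2 / theta) <= C * (lam k)%:R `^ (1 - s / theta).
Proof.
rewrite riesz_seriesE; set S := limn _ => Sfin.
have u0 k : (0 <= ((lam k)%:R `^ (s / theta - 1) *
    \sum_(t <- riesz_terms a lam k.+1) `|t.2| `^ (2 / theta))%:E)%E.
  by rewrite lee_fin mulr_ge0 ?powR_ge0.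
have S0 : (0 <= S)%E by apply: nneseries_ge0 => k _ _; exact: u0.
have Sf : S \is a fin_num by rewrite ge0_fin_numE.
exists (fine S) => k; rewrite -[1 - _]opprB powRN ler_pdivlMr ?powR_gt0 // mulrC.
rewrite -lee_fin fineK //.
apply: le_trans (nneseries_lim_ge k.+1 _) => [|n _ _]; last exact: u0.
by rewrite big_nat_recr //= leeDr // sume_ge0 // => n _; exact: u0.
Qed.

(** The strict gap e > 0 in the exponent makes the terms O(lam_k^-e), hence geometric of ratio
    3^-e. *)
Lemma riesz_series_lty theta s (q C : R) : s / theta - 1 < - q ->
  (forall k, \sum_(t <- riesz_terms a lam k.+1) `|t.2| `^ (2 / theta) <= C * (lam k)%:R `^ q) ->
  (riesz_series a lam theta s < +oo)%E.
Proof.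
move=> sq HC; rewrite riesz_seriesE; set e := - q - (s / theta - 1).
have e0 : 0 < e by rewrite subr_gt0.
have C0 : 0 <= C.
  rewrite -(pmulr_lge0 C (powR_gt0 q (lamR_gt0 0))).
  exact: le_trans (HC 0%N).
apply: (@le_lt_trans _ _ (\sum_(0 <= k <oo) (C * (3 `^ (- e)) ^+ k)%:E)%E).
  apply: lee_nneseries => [k _ _|k _]; first by rewrite lee_fin mulr_ge0 ?powR_ge0.
  rewrite lee_fin; apply: le_trans (ler_wpM2l (powR_ge0 _ _) (HC k)) _.
  rewrite mulrCA ler_wpM2l // -powRD ?(gt_eqF (lamR_gt0 k)) ?implybT //.
  rewrite (_ : s / theta - 1 + q = - e); last by rewrite /e; ring.
  rewrite -powR_mulrn ?powR_ge0 // powRAC; apply: ler_powRN; rewrite ?powR_gt0 ?(ltW e0) //.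
  by rewrite powR_mulrn // -natrX ler_nat expn3_le_lam.
apply: geometric_nneseries_lty => //; rewrite powR_ge0 /= /powR pnatr_eq0 /=.
by rewrite expR_lt1 mulNr oppr_lt0 mulr_gt0 // ln_gt0 // ltr1n.
Qed.

(** Each factor is at most 3/2, as 2/theta >= 2, against lam_k >= 3^k. Thus 0 is admissible and the
    right-hand supremum agrees with the convention sup of the empty set = 0. *)
Lemma riesz_series0_lty theta : (forall j, -1 <= a j <= 1) -> 0 < theta <= 1 ->
  (riesz_series a lam theta 0 < +oo)%E.
Proof.
move=> ab /andP[t0 t1].
have p2 : 2 <= 2 / theta by rewrite ler_pdivlMr // ler_piMr.
apply: (@le_lt_trans _ _ (\sum_(0 <= k <oo) (3 / 2 * (1 / 2) ^+ k : R)%:E)%E); last first.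
  by apply: geometric_nneseries_lty => //; apply/andP; split; lra.
apply: lee_nneseries => [k _ _|k _].
  rewrite lee_fin; apply: mulr_ge0; [exact: powR_ge0|apply: prodr_ge0 => j _].
  by rewrite addr_ge0 // mulr_ge0 ?powR_ge0.
rewrite lee_fin mul0r sub0r powR_inv1 //.
apply: (@le_trans _ _ ((3 ^+ k)^-1 * (3 / 2) ^+ k.+1)).
  rewrite ler_pM ?invr_ge0 //.
  - by rewrite prodr_ge0 // => j _; rewrite addr_ge0 // mulr_ge0 ?powR_ge0.
  - by rewrite lef_pV2 ?posrE ?exprn_gt0 // -natrX ler_nat expn3_le_lam.
  rewrite -[k.+1 in X in _ <= X]card_ord -prodr_const; apply: ler_prod => j _.
  apply/andP; split; first by rewrite addr_ge0 // mulr_ge0 ?powR_ge0.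
  have h1 : `|a j| `^ (2 / theta) <= 1.
    have e1 : 1 `^ (2 / theta) = 1 :> R by rewrite powR1.
    rewrite -[X in _ <= X]e1; apply: ge0_ler_powR; rewrite ?nnegrE //; first lra.
    by rewrite ler_norml.
  have h2 : 2 `^ (1 - 2 / theta) <= 2^-1 :> R.
    by rewrite -(powR_inv1 (ler0n R 2)); apply: ler_powR; [rewrite ler1n|lra].
  have := ler_pM (powR_ge0 _ _) (powR_ge0 _ _) h1 h2; lra.
rewrite le_eqVlt; apply/orP; left; apply/eqP.
rewrite exprS !expr_div_n expr1n; field.
by rewrite !expf_neq0.
Qed.

End Spectrum.

(** * The liminf condition and the dimension formula *)

Lemma limn_einf_gt0 {R : realType} (u : (\bar R)^nat) (c : R) : 0 < c ->
  (\forall n \near \oo, (c%:E <= u n)%E) -> limn_einf u != 0%E.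
Proof.
move=> c0 [N _ HN]; rewrite gt_eqF // limn_einf_lim.
apply: (@lt_le_trans _ _ c%:E); first by rewrite lte_fin.
apply: lime_ge; first exact: is_cvg_einfs.
exists N => // m /= Nm; apply: le_ereal_inf_tmp => _ [k /= mk <-].
by apply: HN => /=; exact: leq_trans mk.
Qed.

(** Taking logarithms, the ratio is at least 2t/p minus a multiple of 1 / log lam_k; half of 2t/p
    survives for large k. *)
Lemma riesz_liminf_neq0 {R : realType} (a : R^nat) (lam : nat -> nat) (p t K : R) :
  (forall j, (0 < lam j)%N) -> (forall j, (3 * lam j <= lam j.+1)%N) ->
  0 < p -> 0 < t -> (forall k, `|a k| `^ p <= K * (lam k)%:R `^ (- t)) ->
  limn_einf (fun k : nat => ((- 2)%:E * lne `|a k|%:E / (ln (lam k)%:R)%:E)%E) != 0%E.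
Proof.
move=> lam_pos lam_lac p0 t0 HK; pose L := Num.max 1 K.
have L1 : 1 <= L by rewrite le_max lexx.
have L0 : 0 < L by apply: lt_le_trans L1.
apply: (@limn_einf_gt0 _ _ (t / p)); first exact: divr_gt0.
near=> k.
have lam3 : 3 ^+ k <= (lam k)%:R :> R by rewrite -natrX ler_nat expn3_le_lam.
have lamR0 : 0 < (lam k)%:R :> R by rewrite ltr0n.
have ln3 : 0 < ln 3 :> R by rewrite ln_gt0 // ltr1n.
have lnk : ln 3 * k%:R <= ln (lam k)%:R :> R.
  rewrite mulr_natr -lnXn // ler_ln ?posrE ?exprn_gt0 //.
(* [lam 0] may be 1, with logarithm 0. *)
have k0 : (0 < k)%N by near: k; exact: nbhs_infty_gt.
have ln0 : 0 < ln (lam k)%:R :> R.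
  by apply: lt_le_trans lnk; rewrite mulr_gt0 // ltr0n.
have kL : 2 * ln L / (t * ln 3) <= k%:R by near: k; exact: nbhs_infty_ger.
rewrite inver gt_eqF //.
(* [lne] is -oo at 0, so a vanishing coefficient gives the ratio +oo. *)
have [a0|a0] := eqVneq (a k) 0.
  rewrite a0 normr0 le0_lneNy // mulrNy ltr0_sg ?oppr_lt0 // EFinN mulN1e /=.
  by rewrite mulyr gtr0_sg ?invr_gt0 // mul1e leey.
have na0 : 0 < `|a k| by rewrite normr_gt0.
rewrite lne_EFin // -!EFinM lee_fin ler_pdivlMr // mulrAC ler_pdivrMr //.
have kL' : 2 * ln L <= t * ln (lam k)%:R.
  move: kL; rewrite ler_pdivrMr ?mulr_gt0 // => /le_trans; apply.
  by rewrite mulrCA ler_pM2l // mulrC.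
have : p * ln `|a k| <= ln L - t * ln (lam k)%:R.
  rewrite -ln_powR -[t * _]opprK -mulNr -ln_powR opprK -lnM ?posrE ?powR_gt0 //.
  rewrite ler_ln ?posrE ?mulr_gt0 ?powR_gt0 //; apply: le_trans (HK k) _.
  by rewrite ler_wpM2r ?powR_ge0 // le_max lexx orbT.
lra.
Unshelve. all: by end_near. Qed.

Theorem theorem3p4 (R : realType) (a : R^nat) (lam : nat -> nat) (C : R)
    (mu : {finite_measure set (measurableTypeR R) -> \bar R})
    (a_bound : forall j, -1 <= a j <= 1)
    (lam_pos : forall j, (0 < lam j)%N)
    (lam_lacunary : forall j, (3 * lam j <= lam j.+1)%N)
    (C_ge3 : 3 <= C)
    (lam_growth : forall j, (lam j.+1)%:R <= C * (lam j)%:R)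
    (liminf0 : limn_einf (fun k : nat =>
        ((- 2)%:E * lne `|a k|%:E / (ln (lam k)%:R)%:E)%E) = 0%E)
    (mu_riesz : is_riesz_product a lam mu)
    (theta : R) (theta01 : 0 < theta <= 1) :
  fourier_spectrum mu theta =
  ereal_sup [set s%:E | s in [set s : R | s <= theta /\
                                 (riesz_series a lam theta s < +oo)%E]].
Proof.
have /andP[t0 t1] := theta01.
have p2 : 2 <= 2 / theta by rewrite ler_pdivlMr // ler_piMr.
have p1 : 1 < 2 / theta by lra.
have lamR0 k : 0 < (lam k)%:R :> R by rewrite ltr0n.
set S := ereal_sup _; rewrite /fourier_spectrum.
set E := ereal_sup [set s%:E | s in [set s : R | 0 <= s /\ _]].
have S_ub s : s <= theta -> (riesz_series a lam theta s < +oo)%E -> (s%:E <= S)%E.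
  by move=> st fin; apply: ereal_sup_ubound; exists s.
have E_ub s : 0 <= s -> (energy mu s theta < +oo)%E -> (s%:E <= maxe 0 E)%E.
  move=> s0 fin; rewrite le_max; apply/orP; right.
  by apply: ereal_sup_ubound; exists s.
have S0 : (0 <= S)%E by apply: S_ub; [exact: ltW|exact: riesz_series0_lty].
apply/eqP; rewrite eq_le; apply/andP; split.
- rewrite ge_max S0 /=; apply: ge_ereal_sup => _ [s [s0 /(energy_ltyP _ _ t0) fin] <-].
  have {}fin := integral_fnorm_jb_lty (ltW (lt_trans ltr01 p1)) fin.
  have [st|st] := leP s theta; last first.
    have e0 : 0 < s / theta - 1 by rewrite subr_gt0 ltr_pdivlMr // mul1r.
    (* Truncated at 2, the largest exponent that the decay of the kernel supports. *)
    pose t := Num.min (s / theta - 1) 2; have tt : 0 < t by rewrite lt_min e0 ltr0n.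
    have t2 : 0 <= t <= 2 by rewrite ltW //= ge_min lexx orbT.
    have fint : (\int[@lebesgue_measure R]_z (fnorm mu z `^ (2 / theta) * jb z `^ t)%:E < +oo)%E.
      apply: le_lt_trans fin; apply: ge0_le_integral => //.
      + by move=> z _; rewrite lee_fin mulr_ge0 ?powR_ge0.
      + apply: measurable_fnorm_mul; exact: continuous_measurable_fun (@continuous_jb_powR R t).
      + apply: measurable_fnorm_mul; exact: continuous_measurable_fun (@continuous_jb_powR R _).
      + move=> z _; rewrite lee_fin ler_wpM2l ?powR_ge0 //.
        by apply: ler_powR; rewrite ?jb_ge1 // ge_min lexx.
    have [K HK] := fcos_decay mu_riesz p1 t2 fint.
    suff /eqP : limn_einf (fun k : nat =>
        ((- 2)%:E * lne `|a k|%:E / (ln (lam k)%:R)%:E)%E) != 0%E by [].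
    (* The coefficient at frequency [lam k] is half of [a k], whence the factor 2^p. *)
    apply: (@riesz_liminf_neq0 _ a lam (2 / theta) t (2 `^ (2 / theta) * K)) => // [|k];
        first lra.
    have K0 : 0 <= K.
      rewrite -(pmulr_lge0 K (powR_gt0 (- t) (jb_gt0 0))).
      by apply: le_trans (HK 0); exact: powR_ge0.
    have := HK (lam k)%:R.
    have -> : (lam k)%:R = ((lam k)%:Z)%:~R :> R by [].
    rewrite (fcos_riesz_term lam_pos lam_lacunary mu_riesz (mem_riesz_terms_lam a lam k)) => H.
    have -> : `|a k| = 2 * `|a k / 2|.
      by rewrite normrM normfV (ger0_norm (ler0n R 2)) mulrCA mulfV ?mulr1 // pnatr_eq0.
    rewrite powRM // -mulrA ler_wpM2l ?powR_ge0 //; apply: le_trans H _.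
    rewrite ler_wpM2l //; apply: ler_powRN (ltW tt); first exact: lamR0.
    by rewrite /jb ger0_norm ?ler0n // lerDr.
  (* The existence of s' in ]0, s[ gives s > 0, so that 1 - s/theta < 1. *)
  apply: lee_approx => // s' /andP[s'0 s's].
  have st1 : s / theta <= 1 by rewrite ler_pdivrMr // mul1r.
  have s0' : 0 < s / theta by rewrite divr_gt0 // (lt_trans s'0).
  have tau : 0 <= 1 - s / theta < 1 by apply/andP; split; lra.
  rewrite -[s / theta - 1]opprB in fin.
  have [K HK] := sum_riesz_terms_le lam_pos lam_lacunary mu_riesz p1 tau fin.
  apply: S_ub; first by apply: le_trans st; exact: ltW.
  have K0 : 0 <= K.
    rewrite -(pmulr_lge0 K (powR_gt0 (1 - s / theta) (lamR0 0))).
    by apply: le_trans (HK 0%N); apply: sumr_ge0 => t _; exact: powR_ge0.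
  (* The product of k + 1 factors is bounded through [lam k.+1], whereas the series pairs it with
     [lam k]; the growth bound converts one into the other at the cost of C^(1 - s/theta). *)
  apply: (@riesz_series_lty _ _ _ lam_pos lam_lacunary _ _ (1 - s / theta) (K * C `^ (1 - s /
      theta))).
    by rewrite opprB ltrD2r ltr_pM2r ?invr_gt0.
  move=> k; apply: le_trans (HK k.+1) _; rewrite -mulrA ler_wpM2l //.
  rewrite -powRM //; last by lra.
  by apply: ge0_ler_powR; rewrite ?nnegrE ?mulr_ge0 //; case/andP: tau => *; lra.
- apply: ge_ereal_sup => _ [s [st /(riesz_series_lty_le lam_pos)[K HK]] <-].
  (* Lowering s to s' opens the gap between q = 1 - s/theta and 1 - s'/theta; q >= 0 by s <= theta,
     and s' > 0 keeps the latter below 1. *)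
  apply: lee_approx => [|s' /andP[s'0 s's]]; first by rewrite le_max lexx.
  apply: E_ub; first exact: ltW.
  apply/(energy_ltyP _ _ t0).
  have st1 : s / theta <= 1 by rewrite ler_pdivrMr // mul1r.
  have qs : 0 <= 1 - s / theta < 1 - s' / theta.
    by apply/andP; split; [lra|rewrite ltrD2l ltrN2 ltr_pM2r ?invr_gt0].
  have s1 : 1 - s' / theta < 1 by rewrite gtrBl divr_gt0.
  rewrite -[s' / theta - 1]opprB.
  exact: (integral_fnorm_norm_lty lam_pos lam_lacunary mu_riesz p1 qs s1 HK).
Qed.
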